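(* For every integer $n\geq 1$ there is a constant $C_n>0$ such that for every integer $d\geq 3$, if $f=\sum_{|\alpha|=d}\varepsilon_\alpha x^\alpha$ is the random sign form of degree $d$ in $x_0,\ldots,x_n$ (with independent uniform signs $\varepsilon_\alpha\in\{-1,1\}$) and $X_f\subset\mathbb P^n_{\mathbb C}$ is the hypersurface it defines, then $$\mathbf P(X_f\text{ is singular})\leq C_n d^{-1/2}.$$
   Context: For a tuple $\alpha=(\alpha_0,\ldots,\alpha_n)$ of nonnegative integers put $|\alpha|=\alpha_0+\cdots+\alpha_n$ and $x^\alpha=x_0^{\alpha_0}\cdots x_n^{\alpha_n}$. The coefficients $\varepsilon_\alpha$, one for each $\alpha$ with $|\alpha|=d$ (so every monomial of degree $d$ occurs), are independent random variables, each equal to $1$ or $-1$ with probability $1/2$; $\mathbf P$ denotes the resulting probability, i.e. the uniform distribution on the $2^{\binom{n+d}{n}}$ sign forms. $X_f\subset\mathbb P^n_{\mathbb C}$ is the closed subscheme $f=0$ with its scheme structure, including any repeated factors. Smooth means geometrically smooth (over $\mathbb C$), and singular means not smooth. *)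

(* Defs.v *)
From HB Require Import structures.
From mathcomp Require Import all_boot all_order all_algebra.
From mathcomp Require Import boolp reals.
From mathcomp Require Import complex.
From mathcomp Require Import mpoly.

Set Implicit Arguments.
Unset Strict Implicit.
Unset Printing Implicit Defensive.

Import Order.TTheory GRing.Theory Num.Theory.
Local Open Scope ring_scope.

(* Exponent tuples alpha with |alpha| = d; the bound d.+1 on the degree only  *)
(* serves to get a finite type.                                               *)
Definition expo (n d : nat) :=
  {a : 'X_{1..n.+1 < d.+1} | mdeg (bmnm a) == d}.

(* A choice of signs, where the boolean b stands for the sign (-1) ^+ b.      *)
Definition signs (n d : nat) := {ffun expo n d -> bool}.

Definition sign_form (K : fieldType) (n d : nat) (e : signs n d) :
    {mpoly K[n.+1]} :=
  \sum_(a : expo n d) (-1) ^+ (e a) *: 'X_[bmnm (val a)].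

(* The equation in n affine coordinates of the part of {f = 0} lying in the   *)
(* chart D_+(x_i) = A^n of P^n: x_i becomes 1, the other variables are        *)
(* renumbered in order.                                                       *)
Definition dehomog (K : fieldType) (n : nat) (i : 'I_n.+1)
    (f : {mpoly K[n.+1]}) : {mpoly K[n]} :=
  f \mPo [tuple if unlift i k is Some j then 'X_j else 1 | k < n.+1].

Definition jacobian (K : fieldType) (n : nat) (g : {mpoly K[n]})
    (y : 'I_n -> K) : 'rV[K]_n :=
  \row_j (g^`M(j)).@[y].

(* The scheme Spec K[y_1, ..., y_n]/(g) is smooth over K of relative          *)
(* dimension n - 1: the 1 x n Jacobian matrix of the presentation has rank 1  *)
(* at every point. As K is algebraically closed, the K-points suffice.        *)
(* The equation g is used as given, so repeated factors are not discarded.    *)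
Definition affine_smooth (K : closedFieldType) (n : nat) (g : {mpoly K[n]}) :=
  forall y : 'I_n -> K, g.@[y] = 0 -> \rank (jacobian g y) = 1%N.

(* Smoothness over K of the closed subscheme f = 0 of P^n, for a nonzero form *)
(* f: smoothness is local, and is tested on the standard affine charts.       *)
Definition smooth_hypersurface (K : closedFieldType) (n : nat)
    (f : {mpoly K[n.+1]}) :=
  forall i : 'I_n.+1, affine_smooth (dehomog i f).

Definition uniform_prob (R : realType) (T : finType) (E : T -> Prop) : R :=
  #|[set t | `[< E t >]]|%:R / #|T|%:R.

(* Main.v *)
(** A singular [X_f] stays degenerate modulo every prime [p] (elimination over
    the integers), so it suffices to bound, for one odd prime [p] of size about
    [sqrt d] not dividing [d], the probability that the partial derivatives of
    [f] have a common nontrivial zero over an algebraically closed field of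
    characteristic [p].  By induction on [n] no such zero lies on a coordinate
    hyperplane, so let [x = (1 : y)] be one with all coordinates nonzero.

    Suppose first that the Frobenius orbit of [y] has a bounded number [r] of
    points.  By Hermite interpolation at these points, about [d / r] disjoint
    translated blocks of [r (n + 1)] monomials have 1-jets at [y] independent
    over [F_p].  A Halasz-type inequality then bounds the probability that [f]
    is singular at [x] by [(C / sqrt d) ^ (r (n + 1))].  As there are only
    [p ^ (r n)] such [y], this adds up to [O(1 / sqrt d)].

    Otherwise, following Poonen, the exponents of [y] divisible by [p] do not
    contribute to the derivatives in [y].  Since there is no zero at infinity,
    these derivatives have at most [d ^ (2 ^ n)] common zeros (a weak Bezout
    bound), which do not depend on the signs at those exponents; at each of them
    these signs make [f] vanish with probability at most [(C d ^ (- 1 / 4)) ^ N],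
    where [N], a lower bound for the size of the orbit, can be taken large. *)

Require Import Defs.
From mathcomp Require Import all_boot all_order all_algebra.
From mathcomp Require Import perm closed_field.
From mathcomp Require Import boolp reals complex mpoly.
From mathcomp Require Import zify ring lra.

Set Implicit Arguments.
Unset Strict Implicit.
Unset Printing Implicit Defensive.

Import Order.TTheory GRing.Theory Num.Theory.

(** * Primes in multiplicative windows *)

(** The size of [p] is forced from both sides. A walk of about [d] steps hits a residue class modulo
    [p] with probability of order [1/p + 1/sqrt d], so [p] must not be of smaller order than
    [sqrt d]. The [p ^ (r n)] points of period [r] are set against [r (n + 1)] factors of order
    [1/sqrt d], so [p] must not be of larger order either. The surplus of one factor per conjugate
    comes from the vanishing of [f] itself beside its derivatives, which Euler's formula supplies as
    [p] does not divide [d]. Signs only see relations over the prime field. Such a relation at a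
    point holds at all its conjugates, so independence at one point follows from Hermite
    interpolation at its whole orbit; this is why the length of the orbit becomes an exponent. For
    unbounded [r] the constants grow like [C ^ r] and too few blocks fit below degree [d], hence the
    separate treatment of long orbits. There only about [d / p], of order [sqrt d], steps of
    exponents divisible by [p] are available, whence the weaker [d ^ (- 1 / 4)]. *)

Lemma prod_prime_divisors_le (a b N : nat) : (0 < N)%N ->
  (forall p, prime p -> a <= p < b -> p %| N)%N ->
  (\prod_(a <= p < b | prime p) p <= N)%N.
Proof.
move=> N0 H.
suff D: forall c, c <= b -> \prod_(a <= p < c | prime p) p %| N.
  by apply: dvdn_leq; rewrite ?D.
elim=> [|c IHc] cb; first by rewrite big_geq // dvd1n.
have [ca|ac] := ltnP c a; first by rewrite big_geq // dvd1n.
rewrite big_mkcond big_nat_recr //= -big_mkcond.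
case: ifP => pc; last by rewrite muln1 IHc // ltnW.
rewrite Gauss_dvd ?IHc ?H //= ?ac ?(ltnW cb) //.
rewrite coprime_sym big_nat_cond.
elim/big_ind: _ => [|x y cx cy|i /andP[/andP[_ ic] pi]].
- exact: coprimen1.
- by rewrite coprimeMr cx.
- by rewrite prime_coprime // dvdn_prime2 //; apply/eqP; lia.
Qed.

Lemma bin_mid_odd_le m : 'C(m.*2.+1, m) <= 4 ^ m.
Proof.
have E: 'C(m.*2.+1, m) = 'C(m.*2.+1, m.+1).
  by rewrite -[in LHS]bin_sub; [congr binomial; lia|lia].
have S: \sum_(i < m.*2.+2) 'C(m.*2.+1, i) = 2 ^ m.*2.+1.
  by rewrite -[2]/(1 + 1) expnDn; apply: eq_bigr => i _; rewrite !exp1n !muln1.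
have: 'C(m.*2.+1, m) + 'C(m.*2.+1, m.+1) <= 2 ^ m.*2.+1.
  rewrite -S.
  have im : m < m.*2.+2 by lia.
  have im1 : m.+1 < m.*2.+2 by lia.
  rewrite (bigD1 (Ordinal im)) //= (bigD1 (Ordinal im1)) /=; last first.
    by rewrite -val_eqE /=; lia.
  by rewrite addnA leq_addr.
rewrite -E addnn expnS -muln2 mulnC leq_pmul2l //.
by rewrite -[4]/(2 ^ 2) -expnM mul2n.
Qed.

(** Erdos's induction: for [n = 2m + 1] the primes in [(m + 1, n]] all divide ['C(n, m)], which is
    at most [4 ^ m]; an even [n > 2] is not prime and adds nothing. *)
Lemma primorial_le n : \prod_(0 <= p < n.+1 | prime p) p <= 4 ^ n.
Proof.
elim/ltn_ind: n => n IH.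
have [n2|n3] := leqP n 2.
  case: n n2 IH => [|[|[|]]] // _ _;
    by rewrite big_mkcond /= /index_iota /= !big_cons big_nil.
have step : ~~ prime n -> \prod_(0 <= p < n.+1 | prime p) p <= 4 ^ n.
  case: n n3 IH => // n n3 IH np.
  rewrite big_mkcond big_nat_recr //= -big_mkcond (negbTE np) muln1.
  by apply: leq_trans (IH n _) _ => //; rewrite leq_exp2l.
have [on|en] := boolP (odd n); last first.
  apply: step; apply/negP => pn; case: (even_prime pn) => [n2|]; first by lia.
  by rewrite (negbTE en).
set m := n./2; have nE : n = m.*2.+1 by rewrite -[LHS]odd_double_half on.
rewrite (@big_cat_nat _ _ _ m.+2) //=; last by lia.
apply: leq_trans (leq_mul (IH m.+1 _) _) _; first by lia.
  apply: (prod_prime_divisors_le (N := 'C(m.*2.+1, m))); first by rewrite bin_gt0; lia.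
  move=> p pp /andP[mp pn].
  have: p %| (m.*2.+1)`! by rewrite dvdn_fact //; lia.
  rewrite -(@bin_fact _ m); last by lia.
  have Fp k : k < p -> (p %| k`!) = false.
    elim: k => [|k IHk] kp; first by rewrite fact0 Euclid_dvd1.
    rewrite factS Euclid_dvdM // IHk ?orbF ?(ltnW kp) //.
    by apply/negP => /dvdn_leq; lia.
  by rewrite !Euclid_dvdM // !Fp ?orbF //; lia.
apply: leq_trans (leq_mul (leqnn _) (bin_mid_odd_le m)) _.
by rewrite -expnD leq_exp2l //; lia.
Qed.

(** In Legendre's formula each [k] contributes [2n %/ p ^ k - 2 (n %/ p ^ k)], which is 0 or 1, and
    is 0 once [p ^ k > 2n]. *)
Lemma logn_bin_mid_le p n : prime p -> 0 < n ->
  logn p 'C(n.*2, n) <= trunc_log p n.*2.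
Proof.
move=> pp n0; have p1 := prime_gt1 pp.
have: logn p (n.*2)`! = logn p 'C(n.*2, n) + (logn p n`! + logn p n`!).
  rewrite -(@bin_fact _ n); last by lia.
  have -> : n.*2 - n = n by lia.
  by rewrite !lognM ?muln_gt0 ?fact_gt0 ?bin_gt0 //; lia.
rewrite !logn_fact // -!big_split /=.
have -> : \sum_(1 <= k < n.+1) (n %/ p ^ k + n %/ p ^ k) =
          \sum_(1 <= k < n.*2.+1) (n %/ p ^ k + n %/ p ^ k).
  rewrite [in RHS](@big_cat_nat _ _ _ n.+1) //=; last by lia.
  rewrite -[LHS]addn0; congr addn.
  rewrite big_nat_cond big1 // => k /andP[/andP[nk _] _].
  by rewrite divn_small //; apply: leq_trans nk (ltnW (ltn_expl _ p1)).
set t := trunc_log p n.*2 => E.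
have bnd k : n.*2 %/ p ^ k <= (k <= t) + (n %/ p ^ k + n %/ p ^ k).
  have [kt|tk] := leqP k t; last first.
    rewrite divn_small //; apply: leq_trans (trunc_log_ltn n.*2 p1) _.
    by rewrite leq_exp2l.
  set q := p ^ k; have q0 : 0 < q by rewrite expn_gt0 ltnW.
  by rewrite -ltnS ltn_divLR // {1}(divn_eq n q); have := ltn_pmod n q0; nia.
have := @leq_sum nat (index_iota 1 n.*2.+1) xpredT _ _ (fun k _ => bnd k).
rewrite big_split /= E leq_add2r => /leq_trans; apply.
elim: n.*2 => [|N IHN]; first by rewrite big_geq.
have [Nt|tN] := leqP N.+1 t.
  apply: leq_trans (_ : N.+1 <= t) => //.
  apply: (@leq_trans (\sum_(1 <= k < N.+2) 1)).
    by apply: leq_sum => k _; exact: leq_b1.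
  by rewrite sum_nat_const_nat muln1 subSS subn0.
by rewrite big_nat_recr //= (ltn_geF tN) addn0.
Qed.

Lemma mul_bin_mid n : n.+1 * 'C(n.+1.*2, n.+1) = (n.*2.+1).*2 * 'C(n.*2, n).
Proof.
have E1 := mul_bin_diag n.+1.*2 n; have E2 := mul_bin_down n.*2.+1 n.
have e : n.*2.+1 - n = n.+1 by lia.
move: E1 E2; rewrite e doubleS /=; nia.
Qed.

Lemma pow4_le_bin_mid n : 4 ^ n <= n.*2.+1 * 'C(n.*2, n).
Proof.
elim: n => [|n IH]; first by rewrite bin0.
have := mul_bin_mid n; rewrite -(leq_pmul2l (ltn0Sn n)) expnS.
rewrite [X in _ <= X]mulnCA => ->; rewrite -doubleMl.
move: IH; move: (n.*2.+1 * _) (4 ^ n) => y z; nia.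
Qed.

(** Erdos's proof of Bertrand's postulate, with a window of ratio 4. Without a prime in it, every
    prime factor of ['C(2n, n)], where [2n = 4 ^ j.+1], would be at most [N = n / 2]; this bounds
    the coefficient by [(2n) ^ s * 4 ^ N], against the lower bound [4 ^ n / (2n + 1)]. Powers of 4
    as endpoints give [2n] the exact square root [s]. *)
Lemma prime_between_pow4 j : 4 <= j ->
  exists2 p, prime p & 4 ^ j < p <= 4 ^ j.+1.
Proof.
move=> j4; set N := 4 ^ j; set n := N.*2.
have [/hasP[p]|/hasPn H] := boolP (has prime (index_iota N.+1 (4 ^ j.+1).+1)).
  by rewrite mem_index_iota => pN pp; exists p => //; lia.
have N0 : 0 < N by rewrite expn_gt0.
have n0 : 0 < n by rewrite /n; lia.
have nE : n.*2 = 4 ^ j.+1 by rewrite expnS /n -/N; lia.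
set s := 2 ^ j.+1; have sE : s * s = n.*2 by rewrite nE -expnMn.
set C := 'C(n.*2, n).
have C0 : 0 < C by rewrite bin_gt0; lia.
have lowC : 4 ^ n <= n.*2.+1 * C by exact: pow4_le_bin_mid.
have upC : C <= n.*2 ^ s * 4 ^ N.
  have -> : C = \prod_(0 <= p < C.+1 | prime p) p ^ logn p C.
    rewrite -[LHS](partnT C0) /partn big_mkcond [RHS]big_mkcond /=.
    apply: eq_bigr => p _; case: ifP => // pp.
    by rewrite lognE pp.
  have big1p a b : N < a -> \prod_(a <= p < b | prime p) p ^ logn p C = 1.
    move=> Na; rewrite big_nat_cond big1 // => p /andP[/andP[ap pb] pp].
    have [pn|np] := leqP p n.*2.
      have: ~~ prime p by apply: H; rewrite mem_index_iota; lia.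
      by rewrite pp.
    have := logn_bin_mid_le pp n0; rewrite -/C.
    have -> : trunc_log p n.*2 = 0 by apply/eqP; rewrite trunc_log_eq0; lia.
    by rewrite leqn0 => /eqP ->.
  have wid b : \prod_(0 <= p < b | prime p) p ^ logn p C <=
               \prod_(0 <= p < N.+1 | prime p) p ^ logn p C.
    have [bN|Nb] := leqP b N.+1.
      rewrite [X in _ <= X](@big_cat_nat _ _ _ b) //= leq_pmulr //.
      by rewrite prodn_cond_gt0 // => p pp; rewrite expn_gt0 prime_gt0.
    by rewrite (@big_cat_nat _ _ _ N.+1) ?(ltnW Nb) //= (big1p N.+1) // muln1.
  apply: leq_trans (wid _) _.
  have sN : s <= N by rewrite /N -[4]/(2 ^ 2) -expnM leq_exp2l //; lia.
  rewrite (@big_cat_nat _ _ _ s.+1) //=; apply: leq_mul.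
    apply: (@leq_trans (\prod_(1 <= p < s.+1) n.*2)).
      rewrite big_ltn_cond //= big_mkcond /=; apply: leq_prod => p _.
      case: ifP => [pp|_]; last by lia.
      apply: leq_trans (_ : p ^ trunc_log p n.*2 <= _).
        by rewrite leq_exp2l ?prime_gt1 // logn_bin_mid_le.
      by rewrite trunc_logP ?prime_gt1 //; lia.
    by rewrite prod_nat_const_nat subSS subn0.
  apply: leq_trans (primorial_le N).
  rewrite [X in _ <= X](@big_cat_nat _ _ _ s.+1) //=.
  apply: (@leq_trans (\prod_(s.+1 <= p < N.+1 | prime p) p)); last first.
    by rewrite leq_pmull // prodn_cond_gt0 // => p /prime_gt0.
  (* Beyond [s] a prime divides the coefficient at most once, so the primorial bound applies. *)
  rewrite big_nat_cond [X in _ <= X]big_nat_cond.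
  apply: leq_prod => p /andP[/andP[sp _] pp].
  rewrite -[X in _ <= X]expn1 leq_exp2l ?prime_gt1 //.
  apply: leq_trans (logn_bin_mid_le pp n0) _.
  rewrite -ltnS ltnNge; apply/negP => t2.
  have: p ^ 2 <= n.*2.
    apply: (@leq_trans (p ^ trunc_log p n.*2)).
      by rewrite leq_pexp2l ?prime_gt0.
    by rewrite trunc_logP ?prime_gt1 //; lia.
  by rewrite -sE; nia.
(* The comparison of the exponents of 4 in the two bounds; it fails at [j = 3]. *)
have N8 : 4 ^ j > j.+2 + j.+1 * 2 ^ j.+1.
  elim: j j4 {N n H N0 n0 nE s sE C C0 lowC upC} => // j IH.
  rewrite leq_eqVlt => /predU1P[[<-]//|/IH]; rewrite !expnS; nia.
have: 4 ^ n <= 4 ^ (j.+2 + j.+1 * s + N).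
  apply: leq_trans lowC _; rewrite -addnA 2!expnD.
  apply: leq_mul.
    rewrite nE (expnS 4 j.+1). have := expn_gt0 4 j.+1. rewrite /=. lia.
  by apply: leq_trans upC _; rewrite nE -expnM leq_mul.
by rewrite leq_exp2l // /n -/N in N8 *; lia.
Qed.

(** For [N <= 4 ^ 4] the window [(4 ^ 4, 4 ^ 5]] serves, whence [1024 = 4 ^ 5]; beyond, rounding up
    to a power of 4 and the window cost a factor 16 in all. *)
Lemma prime_between N : 0 < N -> exists2 p, prime p & N < p <= 1024 * N.
Proof.
move=> N0; have: exists j, N <= 4 ^ j by exists N; apply/ltnW/ltn_expl.
case/ex_minnP => j Nj jmin.
have [j4|j4] := leqP j 4.
  have [p pp pE] := prime_between_pow4 (leqnn 4); exists p; first by [].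
  have : 4 ^ j <= 4 ^ 4 by rewrite leq_exp2l.
  by lia.
have [p pp pE] := prime_between_pow4 (ltnW j4); exists p; first by [].
case: j j4 Nj jmin pE => // j _ Nj jmin pE; rewrite !expnS in Nj pE *.
have : 4 ^ j < N by rewrite ltnNge; apply/negP => /jmin; rewrite ltnn.
move: pE Nj; move: (4 ^ j) => y; lia.
Qed.

Local Open Scope ring_scope.

(** * Anticoncentration of signed sums *)

Lemma sum_mul_sqr_le (T : Type) (r : seq T) (a b : T -> nat) :
  ((\sum_(x <- r) a x * b x) ^ 2 <=
   (\sum_(x <- r) a x ^ 2) * (\sum_(x <- r) b x ^ 2))%N.
Proof.
elim: r => [|x r IH]; first by rewrite !big_nil.
rewrite !big_cons; move: IH (a x) (b x).
move: (\sum_(_ <- _) _)%N (\sum_(_ <- _) _)%N (\sum_(_ <- _) _)%N => Y X A.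
move=> H u v.
have this: (2 * A * (u * v) <= X * v ^ 2 + Y * u ^ 2)%N.
  rewrite -leq_sqr; apply: (@leq_trans (4 * (X * v ^ 2) * (Y * u ^ 2))%N).
    rewrite (_ : (2 * A * (u * v)) ^ 2 = 4 * (u * v) ^ 2 * A ^ 2)%N; last by ring.
    rewrite (_ : 4 * (X * v ^ 2) * (Y * u ^ 2) = 4 * (u * v) ^ 2 * (X * Y))%N; last by ring.
    by rewrite leq_mul2l H orbT.
  move: (X * v ^ 2)%N (Y * u ^ 2)%N => P Q; have [C _] := nat_Cauchy P Q.
  by rewrite sqrnD -(mulnA 4%N); lia.
rewrite (_ : (u ^ 2 + X) * (v ^ 2 + Y) =
             (u * v) ^ 2 + (X * v ^ 2 + Y * u ^ 2) + X * Y)%N; last by ring.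
by rewrite sqrnD; move: this; rewrite -(mulnA 2%N) (mulnC A); lia.
Qed.

Section SignedSums.
Variable V : zmodType.
Implicit Types (s t : seq V) (c : V).

Fixpoint signed_sums s : seq V :=
  if s is v :: s' then
    [seq v + x | x <- signed_sums s'] ++ [seq - v + x | x <- signed_sums s']
  else [:: 0].

Definition sum_count s c := count_mem c (signed_sums s).

Lemma size_signed_sums s : size (signed_sums s) = (2 ^ size s)%N.
Proof.
elim: s => //= v s IH; rewrite size_cat !size_map IH expnS; lia.
Qed.

Lemma sum_count_cons v s c :
  sum_count (v :: s) c = (sum_count s (c - v) + sum_count s (c + v))%N.
Proof.
rewrite /sum_count /= count_cat !count_map; congr addn; apply: eq_count => x /=.
  by rewrite addrC [RHS]eq_sym subr_eq eq_sym.
by rewrite addrC subr_eq.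
Qed.

Lemma sum_count_opp s c : sum_count s (- c) = sum_count s c.
Proof.
elim: s c => [|v s IH] c; first by rewrite /sum_count /= eq_sym oppr_eq0 eq_sym.
rewrite !sum_count_cons addnC -IH opprD opprK; congr addn.
by rewrite -IH opprD !opprK.
Qed.

Lemma sum_count_cat s t c :
  sum_count (s ++ t) c = (\sum_(x <- signed_sums s) sum_count t (c - x))%N.
Proof.
elim: s c => [|v s IH] c /=; first by rewrite big_seq1 subr0.
rewrite sum_count_cons big_cat /= !big_map !IH; congr addn;
  by apply: eq_bigr => x _; congr sum_count; rewrite opprD ?opprK addrA.
Qed.

Lemma sum_count_perm s t c : perm_eq s t -> sum_count s c = sum_count t c.
Proof.
have swap u v r d : sum_count [:: u, v & r] d = sum_count [:: v, u & r] d.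
  rewrite !sum_count_cons addnACA.
  by rewrite [d - u - v]addrAC [d - u + v]addrAC [d + u - v]addrAC [d + u + v]addrAC.
have mid s1 v s2 d : sum_count (s1 ++ v :: s2) d = sum_count (v :: s1 ++ s2) d.
  elim: s1 d => //= u s1 IH d.
  by rewrite sum_count_cons !IH -sum_count_cons swap.
have CA s1 s2 s3 d :
    sum_count (s1 ++ s2 ++ s3) d = sum_count (s2 ++ s1 ++ s3) d.
  elim: s1 d => //= v s1 IH d.
  by rewrite mid !sum_count_cons !IH.
move=> st; pose P r := sum_count s c = sum_count r c.
apply: (@catCA_perm_ind _ P _ s t st) => // s1 s2 s3.
by rewrite /P CA.
Qed.

Lemma sum_count_cat_le s t c B : (forall d, sum_count t d <= B)%N ->
  (sum_count (s ++ t) c <= 2 ^ size s * B)%N.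
Proof.
move=> H; rewrite sum_count_cat -size_signed_sums.
by elim: signed_sums => [|x r IH]; rewrite ?big_nil // big_cons /= mulSn leq_add.
Qed.

(** By the symmetry [sum_count_opp], the vanishing sums of [t ++ t] are the pairs of equal sums of
    [t]. The list [U] stands in for a summation over the group, which may be infinite. *)
Lemma sum_sqr_count_le t (U : seq V) : uniq U ->
  (\sum_(x <- U) sum_count t x ^ 2 <= sum_count (t ++ t) 0)%N.
Proof.
move=> uU; rewrite sum_count_cat.
under [X in (_ <= X)%N]eq_bigr do rewrite sub0r sum_count_opp.
have E x : (sum_count t x ^ 2 =
    \sum_(y <- signed_sums t) (y == x) * sum_count t y)%N.
  rewrite expnS expn1 {1}/sum_count -sum1_count big_distrl /=.
  by rewrite big_mkcond; apply: eq_bigr => y _ /=; case: eqP => [->|].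
under eq_bigr do rewrite E.
rewrite exchange_big /=; apply: leq_sum => y _.
rewrite -big_distrl /= -[X in (_ <= X)%N]mul1n leq_mul2r; apply/orP; right.
rewrite -(big_mkcond (fun x => y == x)) /= sum1_count.
by under eq_count do rewrite eq_sym; rewrite count_uniq_mem ?leq_b1.
Qed.

(** The count is a convolution; Cauchy-Schwarz separates its two factors, and their squared norms
    are again counts, at 0. *)
Lemma sum_count_cauchy s t c :
  (sum_count (s ++ t) c ^ 2 <= sum_count (s ++ s) 0 * sum_count (t ++ t) 0)%N.
Proof.
have -> : sum_count (s ++ t) c =
    (\sum_(x <- undup (signed_sums s)) sum_count s x * sum_count t (c - x))%N.
  rewrite sum_count_cat -big_undup_iterop_count /=; apply: eq_bigr => x _.
  by rewrite Monoid.iteropE iter_addn_0 mulnC.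
apply: leq_trans (sum_mul_sqr_le _ _ _) _.
apply: leq_mul; first exact/sum_sqr_count_le/undup_uniq.
have := @sum_sqr_count_le t [seq c - x | x <- undup (signed_sums s)].
rewrite big_map; apply; rewrite map_inj_uniq ?undup_uniq //.
by move=> x y /addrI /oppr_inj.
Qed.

(* Hoelder's inequality for the Fourier transforms, as iterated Cauchy-Schwarz:
   [2 ^ k] different blocks are no worse than [2 ^ k] copies of one block. *)
Lemma sum_count_blocks_le k (bs : seq (seq V)) B c :
  size bs = (2 ^ k)%N ->
  (forall b d, b \in bs -> sum_count (flatten (nseq (2 ^ k) b)) d <= B)%N ->
  (sum_count (flatten bs) c <= B)%N.
Proof.
elim: k bs c => [|k IH] bs c sz H.
  case: bs sz H => [|b [|]] // _ H.
  by have /= := H b c; rewrite inE eqxx; apply.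
rewrite -leq_sqr -(cat_take_drop (2 ^ k) bs) flatten_cat.
apply: leq_trans (sum_count_cauchy _ _ _) _; rewrite expnS expn1.
(* After Cauchy-Schwarz each half occurs twice; regrouped into doubled blocks [b ++ b] it is a list
   of [2 ^ k] blocks again. *)
have half (r : seq (seq V)) : size r = (2 ^ k)%N -> {subset r <= bs} ->
    (sum_count (flatten r ++ flatten r) 0 <= B)%N.
  move=> szr sub.
  have -> : sum_count (flatten r ++ flatten r) 0 =
            sum_count (flatten [seq b ++ b | b <- r]) 0.
    apply: sum_count_perm; elim: r {szr sub} => //= b r IHr.
    by rewrite -!catA perm_cat2l perm_catCA perm_cat2l.
  apply: IH; first by rewrite size_map.
  move=> _ d /mapP[b br ->]; have := H b d (sub _ br).
  have -> // : flatten (nseq (2 ^ k) (b ++ b)) = flatten (nseq (2 ^ k.+1) b).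
  rewrite expnS mul2n; elim: (2 ^ k)%N => //= j ->.
  by rewrite catA.
apply: leq_mul; apply: half.
- by rewrite size_take sz ltn_exp2l // ltnSn.
- by move=> b /mem_take.
- rewrite size_drop sz expnS; lia.
- by move=> b /mem_drop.
Qed.

Definition int_comb (z : seq int) s : V := \sum_(x <- zip z s) x.2 *~ x.1.

(** For [V] killed by [p] this is linear independence over the prime field, phrased with integers so
    that it makes sense in a bare abelian group. *)
Definition indep_mod (p : nat) s :=
  forall z : seq int, size z = size s -> int_comb z s = 0 ->
  all (fun a => (p%:Z %| a)%Z) z.

Lemma int_comb_cons a z v s : int_comb (a :: z) (v :: s) = v *~ a + int_comb z s.
Proof. by rewrite /int_comb /= big_cons. Qed.

Lemma int_comb_sub z w s : size z = size s -> size w = size s ->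
  exists2 u, size u = size s & int_comb u s = int_comb z s - int_comb w s.
Proof.
elim: s z w => [|v s IH] [|a z] [|b w] //= => [_ _|[sz] [sw]].
  by exists [::] => //; rewrite /int_comb big_nil subrr.
have [u su E] := IH _ _ sz sw; exists (a - b :: u); first by rewrite /= su.
by rewrite !int_comb_cons E mulrzBr opprD addrACA.
Qed.

End SignedSums.

Lemma signed_sums_nseq (V : zmodType) M (v : V) :
  signed_sums (nseq M v) = [seq v *~ a | a <- signed_sums (nseq M (1 : int))].
Proof.
elim: M => //= M IH; rewrite map_cat -!map_comp IH -!map_comp.
by congr cat; apply: eq_map => a /=; rewrite mulrzDr ?mulrNz mulr1z.
Qed.

Section Blocks.
Variables (V : zmodType) (p D M : nat).
Hypothesis D_bound : forall a : int,
  (count (fun b : int => (p%:Z %| (b - a)%R)%Z) (signed_sums (nseq M (1 : int))) <= D)%N.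

Lemma signed_sums_nseqs (s : seq V) x :
  x \in signed_sums (flatten [seq nseq M v | v <- s]) ->
  exists2 z, size z = size s & x = int_comb z s.
Proof.
elim: s x => [|v s IH] x /=.
  by rewrite inE => /eqP ->; exists [::]; rewrite /int_comb ?big_nil.
have cat_sums (s1 s2 : seq V) y : y \in signed_sums (s1 ++ s2) ->
    exists y1 y2, [/\ y1 \in signed_sums s1, y2 \in signed_sums s2 & y = y1 + y2].
  elim: s1 y => [|u s1 IH1] y /=; first by exists 0, y; rewrite inE eqxx add0r.
  rewrite mem_cat => /orP[] /mapP[w /IH1 [y1 [y2 [y1s y2s ->]]] ->];
    [exists (u + y1), y2 | exists (- u + y1), y2];
    by rewrite mem_cat y2s addrA !map_f ?orbT.
case/cat_sums => x1 [y [x1s /IH [z sz ->] ->]].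
move: x1s; rewrite signed_sums_nseq => /mapP[a _ ->].
by exists (a :: z); rewrite /= ?sz ?int_comb_cons.
Qed.

(** The sums are the combinations of [s] whose coefficients are endpoints of independent walks of
    length [M]. By independence a prescribed value fixes every endpoint modulo [p], and a residue
    class is hit at most [D] times. *)
Lemma sum_count_indep_le (s : seq V) c : indep_mod p s ->
  (sum_count (flatten (nseq M s)) c <= D ^ size s)%N.
Proof.
have -> : sum_count (flatten (nseq M s)) c =
          sum_count (flatten [seq nseq M v | v <- s]) c.
  apply: sum_count_perm; apply/seq.permP => a.
  rewrite !count_flatten map_nseq sumn_nseq -map_comp.
  elim: s => //= v s <-; rewrite count_nseq mulnDl; congr addn; lia.
elim: s c => [|v s IH] c ind /=; first by rewrite expn0 /sum_count /= addn0 leq_b1.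
have ind' : indep_mod p s.
  move=> z sz z0; have := ind (0 :: z); rewrite /= sz int_comb_cons mulr0z add0r.
  by move=> /(_ erefl z0) /andP[].
rewrite sum_count_cat signed_sums_nseq big_map.
set t := flatten _ in IH *.
have [/hasP[a0 _ a0P]|/hasPn H] :=
    boolP (has (fun a => 0 < sum_count t (c - v *~ a))%N
               (signed_sums (nseq M (1 : int)))); last first.
  by rewrite big_seq big1 // => a /H; rewrite -eqn0Ngt => /eqP.
have key a : (sum_count t (c - v *~ a) <= (p%:Z %| (a - a0)%R)%Z * D ^ size s)%N.
  case: (posnP (sum_count t (c - v *~ a))) => [->//|aP].
  move: (aP) (a0P); rewrite /sum_count -!has_count !has_pred1.
  move=> /signed_sums_nseqs[z sz zE] /signed_sums_nseqs[w sw wE].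
  have [u su uE] := int_comb_sub sz sw.
  have := ind (a - a0 :: u); rewrite /= su int_comb_cons uE -zE -wE mulrzBr.
  case/(_ erefl _)/andP; last by move=> -> _; rewrite mul1n; exact: IH.
  by rewrite opprB [c - _]addrC addrACA addNKr addKr subrr.
apply: leq_trans (_ : _ <= \sum_(a <- signed_sums (nseq M (1 : int)))
  (p%:Z %| (a - a0)%R)%Z * D ^ size s)%N _; first exact: leq_sum.
rewrite -big_distrl /= expnS leq_mul2r; apply/orP; right.
by apply: leq_trans (D_bound a0); rewrite -sum1_count [X in (_ <= X)%N]big_mkcond.
Qed.

End Blocks.

(** * Endpoints of the simple walk modulo an odd prime *)

Lemma count_walk (P : pred int) M :
  count P (signed_sums (nseq M (1 : int))) =
  (\sum_(0 <= k < M.+1) 'C(M, k) * P (k.*2%:Z - M%:Z)%R)%N.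
Proof.
elim: M P => [|M IH] P; first by rewrite big_nat1 bin0 mul1n subrr /= addn0.
rewrite [LHS]/= count_cat !count_map !IH [RHS]big_nat_recl //= !bin0.
under [X in _ = (_ + X)%N]eq_bigr do rewrite binS mulnDl.
rewrite big_split /= [RHS]addnA [RHS]addnC; congr addn.
  by apply: eq_bigr => k _; congr (_ * P _)%N; lia.
transitivity (\sum_(0 <= k < M.+2) 'C(M, k) * P (k.*2%:Z - M.+1%:Z)%R)%N.
  rewrite [RHS]big_nat_recr //= bin_small // mul0n addn0.
  by apply: eq_bigr => k _; congr (_ * P _)%N; lia.
by rewrite big_nat_recl // bin0.
Qed.

Lemma sum_spaced_windows_le (g : nat -> nat) (Q : pred nat) p N : (0 < p)%N ->
  (forall k l, Q k -> Q l -> k < l -> k + p <= l)%N ->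
  (\sum_(0 <= k < N | Q k) \sum_(0 <= i < p) g (k + i)%N <=
   \sum_(0 <= j < N + p.-1) g j)%N.
Proof.
move=> p0 sp; elim/ltn_ind: N => -[|N] IH; first by rewrite big_geq.
rewrite big_mkcond big_nat_recr //= -big_mkcond /=.
case: ifP => QN; last first.
  rewrite addn0; apply: leq_trans (IH N _) _ => //.
  by rewrite [X in (_ <= X)%N](@big_cat_nat _ _ _ (N + p.-1)) //= ?leq_addr //; lia.
have -> : (\sum_(0 <= k < N | Q k) \sum_(0 <= i < p) g (k + i) =
           \sum_(0 <= k < N.+1 - p | Q k) \sum_(0 <= i < p) g (k + i))%N.
  rewrite (@big_cat_nat _ _ _ (N.+1 - p)) //=; last by lia.
  rewrite [X in (_ + X)%N]big_nat_cond [X in (_ + X)%N]big_pred0 ?addn0 // => k.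
  by apply/negP => /andP[/andP[k1 k2] /sp/(_ QN k2)]; lia.
have -> : (\sum_(0 <= j < N.+1 + p.-1) g j =
  \sum_(0 <= j < N) g j + \sum_(0 <= i < p) g (N + i))%N.
  rewrite (@big_cat_nat _ _ _ N) //=; last by lia.
  congr addn; rewrite -{1}[N]add0n big_addn.
  have -> : (N.+1 + p.-1 - N = p)%N by lia.
  by apply: eq_bigr => i _; rewrite addnC.
rewrite leq_add2r; have [pN|Np] := leqP p N.+1.
  by apply: leq_trans (IH _ _) _; [lia|rewrite (_ : N.+1 - p + p.-1 = N)%N //; lia].
have -> : (N.+1 - p = 0)%N by lia.
by rewrite big_geq.
Qed.

Lemma le_shift_add_drops (g : nat -> nat) p k i : (i <= p)%N ->
  (g k <= g (k + i) + \sum_(0 <= l < p) (g (k + l) - g (k + l).+1))%N.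
Proof.
move=> ip; rewrite (@big_cat_nat _ _ _ i) //= addnA.
apply: leq_trans (leq_addr _ _); elim: i {ip} => [|i IH]; first by rewrite addn0 leq_addr.
by apply: leq_trans IH _; rewrite big_nat_recr //= addnS; lia.
Qed.

(* With [p] the spacing, each [g k] is compared with the average of [g] on
   [k, k + p), the error being the total decrease of [g] there. *)
Lemma sum_spaced_le (g : nat -> nat) (Q : pred nat) p N : (0 < p)%N ->
  (forall k l, Q k -> Q l -> k < l -> k + p <= l)%N ->
  (p * \sum_(0 <= k < N | Q k) g k <=
   \sum_(0 <= j < N + p.-1) g j +
   p * \sum_(0 <= j < N + p.-1) (g j - g j.+1))%N.
Proof.
move=> p0 sp; apply: leq_trans (leq_add (sum_spaced_windows_le g N p0 sp)
  (leq_mul (leqnn p) (sum_spaced_windows_le (fun j => g j - g j.+1)%N N p0 sp))).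
rewrite !big_distrr -big_split /=; apply: leq_sum => k _.
rewrite -[p in (p * g k)%N]subn0 -sum_nat_const_nat -[p in (p * _)%N]subn0.
rewrite -sum_nat_const_nat -big_split /= big_nat_cond [X in (_ <= X)%N]big_nat_cond.
by apply: leq_sum => i /andP[/andP[_ /ltnW/le_shift_add_drops]].
Qed.

Lemma sum_bin_le M N : (\sum_(0 <= j < N) 'C(M, j) <= 2 ^ M)%N.
Proof.
rewrite -[2%N]/(1 + 1)%N expnDn.
under [X in (_ <= X)%N]eq_bigr do rewrite !exp1n !muln1.
rewrite -(big_mkord xpredT (fun j => 'C(M, j))).
have [NM|MN] := leqP N M.+1.
  by rewrite [X in (_ <= X)%N](@big_cat_nat _ _ _ N) //= leq_addr.
rewrite (@big_cat_nat _ _ _ M.+1) ?(ltnW MN) //=.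
rewrite [X in (_ + X <= _)%N]big_nat_cond [X in (_ + X <= _)%N]big1 ?addn0 // => j.
by case/andP => /andP[Mj _] _; rewrite bin_small.
Qed.

(** The row is unimodal: it decreases only after the middle, and there the decreases telescope. The
    term with [maxn N h] in the stronger claim is what has not been lost yet. *)
Lemma sum_bin_drops_le h N :
  (\sum_(0 <= j < N) ('C(h.*2, j) - 'C(h.*2, j.+1)) <= 'C(h.*2, h))%N.
Proof.
suff: (\sum_(0 <= j < N) ('C(h.*2, j) - 'C(h.*2, j.+1)) +
       'C(h.*2, maxn N h) <= 'C(h.*2, h))%N by lia.
elim: N => [|N IH]; first by rewrite big_geq // max0n.
rewrite big_nat_recr //=; have E := mul_bin_left h.*2 N.
have [Nh|hN] := ltnP N h.
  rewrite (maxn_idPr Nh) (maxn_idPr (ltnW Nh)) in IH *.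
  by apply: leq_trans IH; rewrite leq_add2r -[X in (_ <= X)%N]addn0 leq_add2l; nia.
rewrite (maxn_idPl hN) in IH; rewrite (maxn_idPl _); last by lia.
suff : ('C(h.*2, N.+1) <= 'C(h.*2, N))%N by lia.
rewrite -(leq_pmul2l (ltn0Sn N)) E leq_mul2r; apply/orP; right; lia.
Qed.

Definition walk_bound p h := ((2 ^ h.*2 + p * 'C(h.*2, h)) %/ p)%N.

(** Endpoints have the form [2k - 2h], and 2 is invertible modulo the odd [p], so the [k] that hit
    one residue class are at least [p] apart. The bound is an equal share of all walks plus the
    total decrease of the binomial row. *)
Lemma count_walk_mod_le p h (a : int) : prime p -> odd p ->
  (count (fun b : int => (p%:Z %| (b - a)%R)%Z) (signed_sums (nseq h.*2 (1 : int)))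
    <= walk_bound p h)%N.
Proof.
move=> pp op; have p0 := prime_gt0 pp.
rewrite count_walk leq_divRL // mulnC.
set Q := fun k : nat => (p%:Z %| (k.*2%:Z - h.*2%:Z - a)%R)%Z.
have -> : (\sum_(0 <= k < h.*2.+1) 'C(h.*2, k) *
   (p%:Z %| ((k.*2%:Z - h.*2%:Z)%R - a)%R)%Z = \sum_(0 <= k < h.*2.+1 | Q k) 'C(h.*2, k))%N.
  rewrite [RHS]big_mkcond; apply: eq_bigr => k _; rewrite /Q.
  by case: (_ %| _)%Z; rewrite ?muln1 ?muln0.
apply: leq_trans (sum_spaced_le _ _ p0 _) _; last first.
  by rewrite leq_add ?sum_bin_le // leq_mul2l sum_bin_drops_le orbT.
move=> k l Qk Ql kl; suff: (p <= l - k)%N by lia.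
apply: dvdn_leq; first by rewrite subn_gt0.
have: (p%:Z %| (2 * (l - k))%N%:Z)%Z.
  have -> : (2 * (l - k))%N%:Z = (l.*2%:Z - h.*2%:Z - a) - (k.*2%:Z - h.*2%:Z - a) by lia.
  exact: rpredB.
rewrite dvdzE !absz_nat Gauss_dvdr //; last by rewrite coprimen2.
Qed.

Lemma bin_mid_sqr_le h : ('C(h.*2, h) ^ 2 * h.*2.+1 <= 2 ^ (h.*2).*2)%N.
Proof.
elim: h => [|h IH]; first by rewrite bin0.
have h1 : (0 < h.+1 ^ 2)%N by rewrite expn_gt0.
rewrite -(leq_pmul2l h1) mulnA -expnMn mul_bin_mid expnMn.
have -> : (2 ^ (h.+1.*2).*2 = 16 * 2 ^ (h.*2).*2)%N.
  by rewrite -[16%N]/(2 ^ 4)%N -expnD; congr expn; lia.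
apply: (@leq_trans (h.+1 ^ 2 * (16 * ('C(h.*2, h) ^ 2 * h.*2.+1)))%N); last first.
  by rewrite !leq_mul2l IH !orbT.
have : ((h.*2.+1).*2 ^ 2 * h.+1.*2.+1 <= h.+1 ^ 2 * 16 * h.*2.+1)%N.
  by rewrite -!muln2 !expnS !expn0; nia.
move: ('C(_, _) ^ 2)%N => y; nia.
Qed.

(** * Signed sums indexed by a finite type *)

Definition signed_sum (V : zmodType) (I : finType) (v : I -> V)
    (e : {ffun I -> bool}) : V :=
  \sum_i (if e i then - v i else v i).

Lemma card_signed_sum_ord (V : zmodType) n (v : 'I_n -> V) c :
  #|[set e | signed_sum v e == c]| = sum_count [seq v i | i <- enum 'I_n] c.
Proof.
elim: n v c => [|n IH] v c.
  rewrite enum_ord0 /sum_count /= addn0.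
  have [<-|c0] := eqVneq 0 c; last first.
    by apply: eq_card0 => e; rewrite !inE /signed_sum big_ord0 (negbTE c0).
  transitivity #|{ffun 'I_0 -> bool}|; last by rewrite card_ffun card_ord expn0.
  by apply: eq_card => e; rewrite !inE /signed_sum big_ord0 eqxx.
rewrite enum_ordSl /= -map_comp sum_count_cons -!IH.
pose ext (b : bool) (e : {ffun 'I_n -> bool}) : {ffun 'I_n.+1 -> bool} :=
  [ffun i => if unlift ord0 i is Some j then e j else b].
have ext_sum b e : signed_sum v (ext b e) =
    (if b then - v ord0 else v ord0) + signed_sum (v \o lift ord0) e.
  rewrite /signed_sum big_ord_recl ffunE unlift_none; congr (_ + _).
  by apply: eq_bigr => i _; rewrite ffunE liftK.
have ext_inj b : injective (ext b).
  move=> e e' /ffunP H; apply/ffunP => i; have := H (lift ord0 i).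
  by rewrite !ffunE liftK.
rewrite -(card_imset _ (ext_inj false)) -[in X in (_ + X)%N](card_imset _ (ext_inj true)).
rewrite -cardsUI.
have -> : [set ext false e | e in [set e | signed_sum (v \o lift ord0) e == c - v ord0]]
  :&: [set ext true e | e in [set e | signed_sum (v \o lift ord0) e == c + v ord0]] = set0.
  apply/setP => e; rewrite !inE; apply/negP => /andP[/imsetP[e1 _ ->] /imsetP[e2 _]].
  by move=> /ffunP/(_ ord0); rewrite !ffunE unlift_none.
rewrite cards0 addn0; apply: eq_card => e; rewrite !inE.
have eE : e = ext (e ord0) [ffun i => e (lift ord0 i)].
  by apply/ffunP => i; rewrite !ffunE; case: unliftP => [j ->|->]; rewrite ?ffunE.
apply/eqP/orP => [|[]/imsetP[e' +->]]; last 2 first.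
- by rewrite inE ext_sum => /eqP ->; rewrite addrC subrK.
- by rewrite inE ext_sum => /eqP ->; rewrite addrC addrK.
rewrite eE ext_sum; move: [ffun i => _] => e' {eE}.
case: (e ord0) => <-; [right|left]; apply: imset_f; rewrite inE.
  by rewrite addrC addNKr.
by rewrite addrC addKr.
Qed.

Lemma card_signed_sum (V : zmodType) (I : finType) (v : I -> V) c :
  #|[set e | signed_sum v e == c]| = sum_count [seq v i | i <- enum I] c.
Proof.
pose w (i : 'I_#|I|) := v (enum_val i).
have -> : [seq v i | i <- enum I] = [seq w i | i <- enum 'I_#|I|].
  apply: (@eq_from_nth _ 0) => [|i].
    by rewrite (size_map v) (size_map w) -!cardE card_ord.
  rewrite size_map -cardE => iI.
  rewrite (nth_map (enum_val (Ordinal iI))) -?cardE //.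
  rewrite (nth_map (Ordinal iI)) ?size_enum_ord // /w; congr v.
  by rewrite [RHS](enum_val_nth (enum_val (Ordinal iI))) nth_enum_ord.
rewrite -card_signed_sum_ord.
pose f (e : {ffun I -> bool}) : {ffun 'I_#|I| -> bool} := [ffun i => e (enum_val i)].
have f_inj : injective f.
  move=> e e' /ffunP H; apply/ffunP => i; have := H (enum_rank i).
  by rewrite !ffunE enum_rankK.
rewrite -(card_imset _ f_inj); apply: eq_card => e; rewrite !inE.
have fE e' : signed_sum w (f e') = signed_sum v e'.
  rewrite /signed_sum (reindex (@enum_val I I)) /=; last exact/onW_bij/enum_val_bij.
  by apply: eq_bigr => i _; rewrite ffunE.
apply/imsetP/eqP => [[e' +->]|eE]; first by rewrite inE fE => /eqP.
have E : e = f [ffun i => e (enum_rank i)] by apply/ffunP => i; rewrite !ffunE enum_valK.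
by exists [ffun i => e (enum_rank i)]; rewrite // inE -fE -E eE.
Qed.

(** Indices outside [L] cost their full number of sign choices. Among the [2 ^ k] blocks,
    [sum_count_blocks_le] passes to [2 ^ k] copies of a single one, so each of its [m] vectors
    carries a walk of length [2 ^ k]. Independence is therefore asked of one block at a time. *)
Lemma card_signed_sum_le (V : zmodType) (I : finType) (v : I -> V) c p D k m
    (L : seq (seq I)) :
  (forall a : int, (count (fun b : int => (p%:Z %| (b - a)%R)%Z)
     (signed_sums (nseq (2 ^ k) (1 : int))) <= D)%N) ->
  uniq (flatten L) -> size L = (2 ^ k)%N ->
  (forall l, l \in L -> size l = m /\ indep_mod p [seq v i | i <- l]) ->
  (#|[set e | signed_sum v e == c]| * 2 ^ (m * 2 ^ k) <= D ^ m * 2 ^ #|I|)%N.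
Proof.
move=> Db uL szL HL; rewrite card_signed_sum.
pose rest := [seq i <- enum I | i \notin flatten L].
have pE : perm_eq (enum I) (rest ++ flatten L).
  apply: uniq_perm; first exact: enum_uniq.
    rewrite cat_uniq filter_uniq ?enum_uniq // uL andbT.
    by apply/hasPn => i iL; rewrite mem_filter iL.
  by move=> i; rewrite mem_cat [i \in rest]mem_filter !mem_enum !inE andbT orNb.
have szF : size (flatten L) = (m * 2 ^ k)%N.
  rewrite size_flatten /shape -szL.
  elim: L HL {uL szL rest pE} => //= [|l L IH] HL; first by rewrite muln0.
  rewrite IH => [|l' l'L]; last by apply: HL; rewrite inE l'L orbT.
  by have [->] := HL l (mem_head _ _); rewrite mulnS.
have szR : (size rest + m * 2 ^ k = #|I|)%N.
  by rewrite -szF -size_cat -(perm_size pE) cardE.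
rewrite (sum_count_perm _ (perm_map v pE)) map_cat.
rewrite -szR expnD [X in (_ <= X)%N]mulnA leq_mul2r; apply/orP; right.
rewrite mulnC -(size_map v rest); apply: sum_count_cat_le => d.
rewrite map_flatten; apply: (@sum_count_blocks_le _ k); first by rewrite size_map.
move=> b d' /mapP[l lL ->]; have [<- ind] := HL l lL.
by rewrite -(size_map v); apply: sum_count_indep_le.
Qed.

(** * Hermite interpolation at distinct points *)

(** The dual vectors give the evaluation matrix full column rank; [fullrankfun] picks [#|C|] of its
    rows that form an invertible square matrix. *)
Lemma dual_free_family (K : fieldType) (C I : finType) (ev : C -> I -> K) :
  (forall c, exists u : I -> K, forall c', \sum_b u b * ev c' b = (c' == c)%:R) ->
  exists l : seq I, [/\ uniq l, size l = #|C| &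
    forall w : I -> K, (forall c, \sum_(b <- l) w b * ev c b = 0) ->
      forall b, b \in l -> w b = 0].
Proof.
move=> H.
pose A : 'M[K]_(#|I|, #|C|) := \matrix_(i, j) ev (enum_val j) (enum_val i).
have Afull : row_full A.
  rewrite -sub1mx; apply/row_subP => j; rewrite row1.
  have [u uP] := H (enum_val j); apply/submxP.
  exists (\row_i u (enum_val i)); apply/rowP => k; rewrite !mxE eqxx /=.
  transitivity (\sum_b u b * ev (enum_val k) b).
    by rewrite uP (inj_eq enum_val_inj).
  rewrite (reindex (@enum_val I I)) /=; last exact/onW_bij/enum_val_bij.
  by apply: eq_bigr => i _; rewrite !mxE.
pose f := fullrankfun Afull.
exists [seq enum_val (f i) | i <- enum 'I_#|C|]; split.
- rewrite map_inj_uniq ?enum_uniq //; apply: inj_comp; first exact: enum_val_inj.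
  exact: fullrankfun_inj.
- by rewrite size_map size_enum_ord.
move=> w wP b /mapP[i _ ->].
pose W : 'rV[K]_#|C| := \row_i w (enum_val (f i)).
suff /rowP/(_ i) : W = 0 by rewrite !mxE.
have U := fullrowsub_unit Afull; rewrite -[W](mulmxK U).
suff -> : W *m rowsub (fullrankfun Afull) A = 0 by rewrite mul0mx.
apply/rowP => j; rewrite !mxE -[RHS](wP (enum_val j)) big_map big_enum /=.
by apply: eq_bigr => k _; rewrite !mxE.
Qed.

Lemma msizeM_pred_le (K : fieldType) n (g h : {mpoly K[n]}) :
  (msize (g * h) <= (msize g + msize h).-1)%N.
Proof.
have [->|g0] := eqVneq g 0; first by rewrite mul0r msize0.
have [->|h0] := eqVneq h 0; first by rewrite mulr0 msize0.
by rewrite msizeM.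
Qed.

Section Jets.
Variables (K : fieldType) (n : nat).
Implicit Types (y : 'I_n -> K) (b : 'X_{1..n}).

Definition mon y b : K := \prod_i y i ^+ b i.

(** The value ([None]) and the derivatives multiplied by [y i]: monomials become eigenvectors with
    eigenvalue [b i], and no exponent is lowered. *)
Definition jet y (o : option 'I_n) b : K :=
  (if o is Some i then (b i)%:R else 1) * mon y b.

Definition poly_jet y (o : option 'I_n) (g : {mpoly K[n]}) : K :=
  if o is Some i then y i * (g^`M(i)).@[y] else g.@[y].

Lemma monU y b i :
  y i * ((b i)%:R * mon y (b - U_(i))%MM) = (b i)%:R * mon y b.
Proof.
have [->|bi] := posnP (b i); first by rewrite !mul0r mulr0.
rewrite mulrCA; congr (_ * _); rewrite /mon (bigD1 i) //= [RHS](bigD1 i) //= mnmBE mnm1E eqxx.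
rewrite mulrA -exprS subn1 prednK //; congr (_ * _); apply: eq_bigr => j ji.
by rewrite mnmBE mnm1E eq_sym (negbTE ji) subn0.
Qed.

Lemma poly_jetX y o b : poly_jet y o 'X_[b] = jet y o b.
Proof.
case: o => [i|] /=; last by rewrite mevalX /jet mul1r.
by rewrite mderivX mevalZ mevalX -/(mon y _) monU.
Qed.

Lemma poly_jet_linear y o a g h :
  poly_jet y o (a *: g + h) = a * poly_jet y o g + poly_jet y o h.
Proof.
case: o => [i|] /=; last by rewrite mevalD mevalZ.
by rewrite mderivD mderivZ mevalD mevalZ mulrDr mulrCA.
Qed.

Lemma poly_jet_sum y o (I : Type) (s : seq I) (a : I -> K) (g : I -> {mpoly K[n]}) :
  poly_jet y o (\sum_(i <- s) a i *: g i) = \sum_(i <- s) a i * poly_jet y o (g i).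
Proof.
elim/big_rec2: _ => [|i s1 s2 _ <-]; last exact: poly_jet_linear.
by case: o => [i|] /=; rewrite ?mderiv0 meval0 ?mulr0.
Qed.

Lemma poly_jetE y o N g : (msize g <= N)%N ->
  poly_jet y o g = \sum_(b : 'X_{1..n < N}) g@_b * jet y o b.
Proof.
move=> gN; rewrite [in LHS](mpolywE gN) poly_jet_sum.
by apply: eq_bigr => b _; rewrite poly_jetX.
Qed.

Section Interpolation.
Variables (r : nat) (P : 'I_r -> 'I_n -> K).
Hypothesis P_sep : forall j k, j != k -> exists i, P j i != P k i.
Hypothesis P_torus : forall j i, P j i != 0.

(** A product of squared linear factors ['X_i - P k i], one for each [k != j], with [i] a coordinate
    that separates [P k] from [P j]. Squaring makes the derivatives vanish too; [msize] is the
    degree plus one. *)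
Lemma sep_poly j : exists q : {mpoly K[n]},
  [/\ (msize q <= r.-1.*2.+1)%N, q.@[P j] != 0 &
    forall k, k != j -> q.@[P k] = 0 /\ forall i, (q^`M(i)).@[P k] = 0].
Proof.
pose s := rem j (enum 'I_r).
have js : j \notin s by rewrite mem_rem_uniqF ?enum_uniq.
have sP k : k != j -> k \in s by rewrite mem_rem_uniq ?enum_uniq // inE mem_enum => ->.
have -> : r.-1 = size s by rewrite size_rem ?mem_enum // size_enum_ord.
suff [q [sq qj qP]] : exists q : {mpoly K[n]},
  [/\ (msize q <= (size s).*2.+1)%N, q.@[P j] != 0 &
    forall k, k \in s -> q.@[P k] = 0 /\ forall i, (q^`M(i)).@[P k] = 0].
  by exists q; split=> // k /sP; exact: qP.
elim: s js {sP} => [_|k s IH].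
  by exists 1; rewrite msize1 meval1 oner_eq0; split.
rewrite inE negb_or => /andP[jk /IH[q [sq qj qP]]].
have [i ji] := P_sep jk.
pose l : {mpoly K[n]} := 'X_i - (P k i)%:MP.
have lk : l.@[P k] = 0 by rewrite mevalB mevalXU mevalC subrr.
have sl : (msize l <= 2)%N.
  rewrite /l -mpolyCN; apply: leq_trans (mmeasureD_le _ _ _) _.
  by rewrite msizeX mdeg1 mmeasureC geq_max /= (leq_trans (leq_b1 _)).
have lj : l.@[P j] != 0 by rewrite mevalB mevalXU mevalC subr_eq0.
clearbody l; exists (l * (l * q)); split.
- have M1 := msizeM_pred_le l q; have M2 := msizeM_pred_le l (l * q).
  rewrite [size _]/= doubleS; apply: leq_trans M2 _.
  move: M1 sl sq; move: (msize (l * q)) (msize l) (msize q) (size s).*2%N => x y z S.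
  lia.
- by rewrite !mevalM !mulf_neq0.
move=> k'; rewrite inE => /predU1P[->|/qP[q0 dq0]].
  split=> [|i']; first by rewrite !mevalM lk !mul0r.
  by rewrite !(mderivM, mevalD, mevalM) lk !(mul0r, mulr0, addr0).
split=> [|i']; first by rewrite !mevalM q0 !mulr0.
by rewrite !(mderivM, mevalD, mevalM) q0 dq0 !(mul0r, mulr0, addr0).
Qed.

Lemma dual_jets (c : 'I_r * option 'I_n) : exists2 g : {mpoly K[n]},
  (msize g <= r.*2)%N & forall c', poly_jet (P c'.1) c'.2 g = (c' == c)%:R.
Proof.
case: c => j o; have r0 : (0 < r)%N by case: (r) j => [[]|].
have [q [sq qj qP]] := sep_poly j.
pose a := q.@[P j].
have jet0 g (c' : 'I_r * option 'I_n) : c'.1 != j ->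
    poly_jet (P c'.1) c'.2 (q * g) = 0.
  case: c' => k [i|] /= kj; have [q0 dq0] := qP k kj; last by rewrite mevalM q0 mul0r.
  by rewrite mderivM mevalD !mevalM q0 dq0 !mul0r addr0 mulr0.
(* The linear factor kills the value at [P j] and leaves only the derivative along [i]; its
   normalisation uses that [P j] lies in the torus. *)
pose g i : {mpoly K[n]} := q * ((a * P j i)^-1 *: ('X_i - (P j i)%:MP)).
have sg i : (msize (g i) <= r.*2)%N.
  apply: leq_trans (msizeM_pred_le _ _) _.
  have : (msize ((a * P j i)^-1 *: ('X_i - (P j i)%:MP_[n])) <= 2)%N.
    apply: leq_trans (msizeZ_le _ _) _.
    rewrite -mpolyCN; apply: leq_trans (mmeasureD_le _ _ _) _.
    by rewrite msizeX mdeg1 mmeasureC geq_max /= (leq_trans (leq_b1 _)).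
  by move: sq r0; move: (msize q) (msize (_ *: _)) => x y; lia.
have gP i c' : poly_jet (P c'.1) c'.2 (g i) = (c' == (j, Some i))%:R.
  have [c'j|c'j] := eqVneq c'.1 j; last first.
    by rewrite jet0 //; case: eqP => // c'E; rewrite c'E eqxx in c'j.
  case: c' c'j => _ [i'|] /= ->; rewrite xpair_eqE eqxx /=; last first.
    by rewrite mevalM mevalZ mevalB mevalXU mevalC subrr !mulr0.
  rewrite mderivM mevalD !mevalM mderivZ !mevalZ mevalB mevalXU mevalC subrr.
  rewrite !mulr0 add0r mderivB mderivC subr0 mderivX mevalZ mnm1E.
  have [->|ii'] := eqVneq i i'; last first.
    by rewrite !mul0r !mulr0 /eq_op /= eq_sym (negbTE ii').
  have -> : (U_(i') - U_(i') = 0)%MM by apply/mnmP => m; rewrite mnmBE subnn mnm0E.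
  rewrite mpolyX0 meval1 !mulr1 -/a [RHS](_ : _ = 1); last by rewrite eqxx.
  by rewrite mulrA mulrC [P _ _ * _]mulrC mulVf // mulf_neq0.
case: o => [i|]; first by exists (g i).
(* [a^-1 *: q] has value 1 at [P j]; the multiples [t i] of [g i] cancel its derivatives there. *)
pose t i := - (a^-1 * poly_jet (P j) (Some i) q).
exists (a^-1 *: q + \sum_i t i *: g i).
  apply: leq_trans (mmeasureD_le _ _ _) _; rewrite geq_max; apply/andP; split.
    by apply: leq_trans (msizeZ_le _ _) _; apply: leq_trans sq _; lia.
  elim/big_ind: _ => [|x y xl yl|i _]; first by rewrite msize0.
    by apply: leq_trans (mmeasureD_le _ _ _) _; rewrite geq_max xl.
  by apply: leq_trans (msizeZ_le _ _) _.
move=> c'; rewrite poly_jet_linear poly_jet_sum.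
under eq_bigr do rewrite gP.
have [c'j|c'j] := eqVneq c'.1 j; last first.
  have ne o' : (c' == (j, o')) = false by apply: contraNF c'j => /eqP ->.
  rewrite big1 => [|i _]; last by rewrite ne mulr0.
  by rewrite addr0 -[q]mulr1 jet0 // mulr0 ne.
case: c' c'j => _ o /= ->; rewrite xpair_eqE /= eqxx /=.
case: o => [i|] /=; last first.
  rewrite big1 ?addr0 => [|i _]; first by rewrite mulVf.
  by rewrite xpair_eqE andbF mulr0.
rewrite (bigD1 i) //= big1 ?addr0 => [|i' i'i]; last first.
  rewrite xpair_eqE (_ : (Some i == Some i') = (i == i')) //.
  by rewrite eq_sym (negbTE i'i) andbF mulr0.
by rewrite eqxx mulr1 /t /= subrr.
Qed.

Lemma interpolating_exponents : exists l : seq 'X_{1..n < r.*2},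
  [/\ uniq l, size l = (r * n.+1)%N &
    forall w : 'X_{1..n < r.*2} -> K,
      (forall j o, \sum_(a <- l) w a * jet (P j) o a = 0) ->
      forall b : 'X_{1..n < r.*2}, b \in l -> w b = 0].
Proof.
pose C : finType := ('I_r * option 'I_n)%type.
have [|l [ul sl lP]] := @dual_free_family K C 'X_{1..n < r.*2}
    (fun c (b : 'X_{1..n < r.*2}) => jet (P c.1) c.2 b).
  move=> c; have [g sg gP] := dual_jets c.
  by exists (fun a : 'X_{1..n < r.*2} => g@_a) => c'; rewrite -gP (poly_jetE _ _ sg).
exists l; split=> //; first by rewrite sl card_prod card_option !card_ord.
by move=> w wP; apply: lP => c; apply: wP.
Qed.

Lemma interpolating_exponents_values : exists l : seq 'X_{1..n < r.*2},
  [/\ uniq l, size l = r &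
    forall w : 'X_{1..n < r.*2} -> K,
      (forall j, \sum_(a <- l) w a * mon (P j) a = 0) ->
      forall b : 'X_{1..n < r.*2}, b \in l -> w b = 0].
Proof.
have [|l [ul sl lP]] := @dual_free_family K 'I_r 'X_{1..n < r.*2}
    (fun j (b : 'X_{1..n < r.*2}) => mon (P j) b).
  move=> j; have [g sg gP] := dual_jets (j, None).
  exists (fun a : 'X_{1..n < r.*2} => g@_a) => j'.
  have := gP (j', None); rewrite (poly_jetE _ _ sg) xpair_eqE /= andbT => <-.
  by apply: eq_bigr => b _; rewrite /jet mul1r.
by exists l; rewrite card_ord in sl; split.
Qed.

End Interpolation.
End Jets.

(** * Frobenius orbits *)

Lemma int_comb_map (V : zmodType) (I : eqType) (v : I -> V) (l : seq I) z :
  uniq l -> size z = size l ->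
  int_comb z [seq v i | i <- l] = \sum_(i <- l) v i *~ z`_(index i l).
Proof.
elim: l z => [|i l IH] [|a z] //=; first by rewrite /int_comb !big_nil.
move=> /andP[il ul] [sz]; rewrite int_comb_cons IH // big_cons eqxx /=.
congr (_ + _); apply: eq_big_seq => j jl.
by case: eqP => // ij; rewrite ij jl in il.
Qed.

Lemma indep_mod_map (K : fieldType) (p : nat) (V : zmodType) (I : eqType)
    (v : I -> V) (l : seq I) : p \in [pchar K] -> uniq l ->
  (forall z : I -> int, \sum_(i <- l) v i *~ z i = 0 ->
     forall i, i \in l -> (z i)%:~R = 0 :> K) ->
  indep_mod p [seq v i | i <- l].
Proof.
move=> chp ul H z; rewrite size_map => sz.
rewrite int_comb_map // => /H z0; apply/(all_nthP 0) => k; rewrite sz => kl.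
have [i0 _] : exists2 i, i \in l & i \in l.
  by case: (l) kl => [|i l'] // _; exists i; rewrite mem_head.
have := z0 (nth i0 l k) (mem_nth _ kl).
by rewrite index_uniq // (dvdz_pcharf chp) => ->.
Qed.

Lemma ffun_mulrzE (A : finType) (V : zmodType) (f : {ffun A -> V}) (z : int) a :
  (f *~ z) a = f a *~ z.
Proof. by case: z => m; rewrite ?NegzE ?mulrNz ?ffunE -!pmulrn ?ffunMnE. Qed.

Section Frobenius.
Variables (K : fieldType) (p : nat).
Hypothesis chp : p \in [pchar K].

(** Frobenius fixes the integer coefficients, so it carries a relation to the conjugates. *)
Lemma frob_comb (I : Type) (l : seq I) (z : I -> int) (y : I -> K) j :
  \sum_(b <- l) (z b)%:~R * y b = 0 ->
  \sum_(b <- l) (z b)%:~R * y b ^+ (p ^ j) = 0.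
Proof.
elim: j => [|j IH].
  by move=> H; rewrite -[RHS]H; apply: eq_bigr => b _; rewrite expn0 expr1.
move/IH => {IH} /(congr1 (pFrobenius_aut chp)).
rewrite rmorph0 rmorph_sum /= => H; rewrite -[RHS]H; apply: eq_bigr => b _.
by rewrite rmorphM rmorph_int /= pFrobenius_autE expnSr exprM.
Qed.

Lemma frob_inj j : injective (fun y : K => y ^+ (p ^ j)).
Proof.
elim: j => [|j IH] x y /=; first by rewrite !expr1.
by rewrite expnSr !exprM -!(pFrobenius_autE chp) => /fmorph_inj /IH.
Qed.

Lemma natr_frob j m : (m%:R : K) ^+ (p ^ j) = m%:R.
Proof.
elim: j => [|j IH]; first by rewrite expn0 expr1.
by rewrite expnSr exprM IH -(pFrobenius_autE chp) rmorph_nat.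
Qed.

Variable n : nat.
Implicit Type x : 'I_n -> K.

Definition frob_fixed r x := [forall i, x i ^+ (p ^ r) == x i].

(** Exactly what keeps the first [r] conjugates distinct; [r] itself may fail to be a period, so
    that long orbits are covered too. *)
Definition no_small_period r x := forall s, (0 < s < r)%N -> ~~ frob_fixed s x.

Lemma frob_orbit_sep x r : no_small_period r x ->
  forall j k : 'I_r, j != k -> exists i, x i ^+ (p ^ j) != x i ^+ (p ^ k).
Proof.
move=> H.
have sep (j k : 'I_r) : (j < k)%N -> exists i, x i ^+ (p ^ j) != x i ^+ (p ^ k).
  move=> jk; have /forallPn[i xi] : ~~ frob_fixed (k - j) x.
    by apply: H; have := ltn_ord k; lia.
  exists i; apply: contra xi => /eqP E; apply/eqP/(@frob_inj j) => /=.
  by rewrite -exprM -expnD subnK ?(ltnW jk).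
move=> j k jk; case: (ltngtP j k) => [|kj|/val_inj E]; first exact: sep.
  by have [m] := sep _ _ kj; rewrite eq_sym; exists m.
by rewrite E eqxx in jk.
Qed.

Lemma monX x b j : mon (fun i => x i ^+ j) b = mon x b ^+ j.
Proof.
by rewrite /mon -prodrXl; apply: eq_bigr => i _; rewrite -!exprM mulnC.
Qed.

Lemma monD x b c : mon x (b + c)%MM = mon x b * mon x c.
Proof. by rewrite /mon -big_split; apply: eq_bigr => i _; rewrite mnmDE exprD. Qed.

Lemma mon_neq0 x b : (forall i, x i != 0) -> mon x b != 0.
Proof. by move=> x0; apply/prodf_neq0 => i _; rewrite expf_neq0. Qed.

Definition jet_vec x b : {ffun option 'I_n -> K} := [ffun o => jet x o b].

(** One list [l] serves all translates: shifting exponents by [c] scales the jets by [mon x c] and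
    adds [c i] times the value to the derivative along [i], a triangular change. The interpolation
    points are the conjugates of [x]. *)
Lemma indep_jets x r : (forall i, x i != 0) -> no_small_period r x ->
  exists l : seq 'X_{1..n < r.*2}, [/\ uniq l, size l = (r * n.+1)%N &
    forall c : 'X_{1..n}, indep_mod p [seq jet_vec x (c + bmnm a)%MM | a <- l]].
Proof.
move=> x0 H; pose P (j : 'I_r) i := x i ^+ (p ^ j).
have P0 j i : P j i != 0 by rewrite expf_neq0.
have [l [ul sl lP]] := interpolating_exponents (frob_orbit_sep H) P0.
exists l; split=> // c; apply: (indep_mod_map chp) => // z z0.
have c0 : mon x c != 0 by rewrite mon_neq0.
have E o : \sum_(a <- l) (z a)%:~R * jet x o (c + bmnm a)%MM = 0.
  have := congr1 (fun f : {ffun _} => f o) z0.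
  rewrite sum_ffunE !ffunE => z0E; rewrite -[RHS]z0E; apply: eq_bigr => a _.
  by rewrite ffun_mulrzE ffunE mulrzl.
have E0 : \sum_(a <- l) (z a)%:~R * mon x a = 0.
  apply: (mulfI c0); rewrite mulr0 -[RHS](E None) mulr_sumr.
  by apply: eq_bigr => a _; rewrite /jet monD mul1r mulrCA.
have E1 i : \sum_(a <- l) (z a)%:~R * ((a i)%:R * mon x a) = 0.
  apply: (mulfI c0); rewrite mulr0 -[RHS](E (Some i)).
  transitivity (\sum_(a <- l) (z a)%:~R * jet x (Some i) (c + bmnm a)%MM -
     (c i)%:R * mon x c * \sum_(a <- l) (z a)%:~R * mon x a).
    rewrite !mulr_sumr -sumrB; apply: eq_bigr => a _.
    by rewrite /jet monD mnmDE natrD; ring.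
  by rewrite E0 mulr0 subr0.
apply: lP => j o; case: o => [i|].
  rewrite -[RHS](frob_comb j (E1 i)); apply: eq_bigr => a _.
  rewrite /jet /P monX exprMn; by rewrite natr_frob.
rewrite -[RHS](frob_comb j E0); apply: eq_bigr => a _.
by rewrite /jet mul1r monX.
Qed.

(** A relation between these [p]-th powers is the [p]-th power of a relation between the monomials
    without the factor [p], and Frobenius is injective. *)
Lemma indep_mons x r : (forall i, x i != 0) -> no_small_period r x ->
  exists l : seq 'X_{1..n < r.*2}, [/\ uniq l, size l = r &
    forall c : 'X_{1..n}, indep_mod p [seq mon x ((c + bmnm a) *+ p)%MM | a <- l]].
Proof.
move=> x0 H; pose P (j : 'I_r) i := x i ^+ (p ^ j).
have P0 j i : P j i != 0 by rewrite expf_neq0.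
have [l [ul sl lP]] := interpolating_exponents_values (frob_orbit_sep H) P0.
exists l; split=> // c; apply: (indep_mod_map chp) => // z z0.
have c0 : mon x c != 0 by rewrite mon_neq0.
have E0 : \sum_(a <- l) (z a)%:~R * mon x a = 0.
  apply: (@frob_inj 1) => /=; rewrite expn1 expr0n (gtn_eqF (prime_gt0 (pcharf_prime chp))).
  apply: (mulfI (expf_neq0 p c0)); rewrite mulr0 -[RHS]z0.
  rewrite -(pFrobenius_autE chp (\sum_(a <- l) _)) rmorph_sum mulr_sumr /=.
  apply: eq_bigr => a _; rewrite rmorphM rmorph_int /= pFrobenius_autE.
  rewrite -[RHS]mulrzl mulrCA -exprMn -monD; congr (_ * _).
  rewrite /mon -prodrXl; apply: eq_bigr => i _.
  by rewrite mulmnE exprM.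
apply: lP => j; rewrite -[RHS](frob_comb j E0); apply: eq_bigr => a _.
by rewrite monX.
Qed.

End Frobenius.

(** * Elimination *)

(* Sylvester matrix for the formal degrees [(d, d)]: unlike that of [resultant],
   its size is preserved when a ring morphism lowers the degrees. *)
Definition sylv (S : comNzRingType) d (p q : {poly S}) : 'M[S]_(d + d) :=
  \matrix_(i, k) match split i with
                 | inl i' => (p * 'X^i')`_k
                 | inr i' => (q * 'X^i')`_k
                 end.

Lemma map_sylv (S S' : comNzRingType) (f : {rmorphism S -> S'}) d (p q : {poly S}) :
  map_mx f (sylv d p q) = sylv d (map_poly f p) (map_poly f q).
Proof.
apply/matrixP => i k; rewrite !mxE.
by case: (split i) => j; rewrite -coef_map rmorphM /= map_polyXn.
Qed.

Lemma rVpolyE (S : nzRingType) d (v : 'rV[S]_d) :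
  rVpoly v = \sum_j v 0 j *: 'X^j.
Proof. by rewrite /rVpoly poly_def; apply: eq_bigr => j _; rewrite valK. Qed.

(** The exact degree of [p] excludes a common root at infinity. A left kernel vector is a relation
    between [p] and [q] with cofactors of size at most [d]; if [p] and [q] were coprime, [p] would
    divide the nonzero cofactor of [q], of lower degree. Conversely the powers of a common root form
    a right kernel vector. *)
Lemma det_sylv_eq0 (L : closedFieldType) d (p q : {poly L}) :
  size p = d.+1 -> (size q <= d.+1)%N ->
  (\det (sylv d p q) == 0) <-> (exists2 b, root p b & root q b).
Proof.
move=> sp sq.
have p0 : p != 0 by rewrite -size_poly_gt0 sp.
have rowE (u : 'rV[L]_(d + d)) k :
    (u *m sylv d p q) 0 k = (p * rVpoly (lsubmx u) + q * rVpoly (rsubmx u))`_k.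
  have mulE (r : {poly L}) (v : 'rV[L]_d) :
      r * rVpoly v = \sum_j v 0 j *: (r * 'X^j).
    by rewrite rVpolyE mulr_sumr; apply: eq_bigr => j _; rewrite -scalerAr.
  rewrite !mulE !mxE big_split_ord /= coefD !coef_sum.
  congr (_ + _); apply: eq_bigr => j _; rewrite !mxE coefZ.
    by rewrite (unsplitK (inl j)).
  by rewrite (unsplitK (inr j)).
split=> [/det0P[u u0 uM]|[b pb qb]].
  have E : p * rVpoly (lsubmx u) + q * rVpoly (rsubmx u) = 0.
    apply/polyP => k; rewrite coef0; have [kd|dk] := ltnP k (d + d).
      by rewrite -(rowE u (Ordinal kd)) uM mxE.
    rewrite nth_default //; apply: leq_trans dk.
    have szM (a : {poly L}) (v : 'rV_d) :
        (size a <= d.+1)%N -> (size (a * rVpoly v)%R <= d + d)%N.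
      move=> sa; have [->|a0] := eqVneq a 0; first by rewrite mul0r size_poly0.
      have [->|v0] := eqVneq (rVpoly v) 0; first by rewrite mulr0 size_poly0.
      rewrite size_mul //; have : (size (rVpoly v) <= d)%N by exact: size_poly.
      by move: sa; move: (size a) (size (rVpoly v)) => x y; lia.
    apply: leq_trans (size_polyD _ _) _; rewrite geq_max !szM //.
    by rewrite sp.
  have v0 : rVpoly (rsubmx u) != 0.
    apply: contraNneq u0 => v0; rewrite -[u]hsubmxK.
    move: E; rewrite v0 mulr0 addr0 => /eqP; rewrite mulf_eq0 (negbTE p0) /=.
    move=> /eqP l0; rewrite -[lsubmx u]rVpolyK -[rsubmx u]rVpolyK l0 v0 !linear0.
    by rewrite row_mx0.
  have : ~~ coprimep p q.
    apply/negP => cpq.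
    have : p %| rVpoly (rsubmx u).
      rewrite -(Gauss_dvdpr _ cpq); apply/dvdpP; exists (- rVpoly (lsubmx u)).
      by apply/eqP; rewrite -subr_eq0 mulNr opprK [_ * p]mulrC addrC E.
    move/(dvdp_leq v0); rewrite sp leqNgt ltnS; apply/negP; rewrite negbK.
    exact: size_poly.
  rewrite /coprimep => /closed_rootP[b]; rewrite root_gcd => /andP[pb qb].
  by exists b.
have d0 : (0 < d)%N.
  rewrite lt0n; apply: contraTneq pb => d0.
  by move: sp; rewrite d0 => /eqP/size_poly1P[c c0 ->]; rewrite rootC.
rewrite -det_tr; apply/det0P; exists (\row_(k < d + d) b ^+ k).
  apply/eqP => /rowP/(_ (Ordinal (ltn_addr d d0))) /eqP.
  by rewrite !mxE expr0 oner_eq0.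
apply/rowP => i; rewrite !mxE.
transitivity (match split i with inl i' => p * 'X^i' | inr i' => q * 'X^i' end).[b].
  rewrite (@horner_coef_wide _ (d + d)).
    by apply: eq_bigr => k _; rewrite !mxE mulrC; case: (split i).
  have szX (r : {poly L}) (j : 'I_d) :
      (size r <= d.+1)%N -> (size (r * 'X^j)%R <= d + d)%N.
    move=> sr; have [->|r0] := eqVneq r 0; first by rewrite mul0r size_poly0.
    by rewrite size_mulXn //; have := ltn_ord j; lia.
  by case: (split i) => j; apply: szX; rewrite ?sp.
by case: (split i) => j; rewrite hornerM ?(rootP pb) ?(rootP qb) mul0r.
Qed.

Section Elimination.
Variables (S : comNzRingType).

(* Eliminating between [p] and the pencil with an indeterminate parameter treats
   all of [qs] at once, without the choice of generic coefficients. *)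
Definition pencil (qs : seq {poly S}) : {poly {poly S}} :=
  \sum_(j < size qs) ('X^j : {poly S}) *: map_poly polyC qs`_j.

Definition elim_poly d (p : {poly S}) qs : {poly S} :=
  \det (sylv d (map_poly polyC p) (pencil qs)).

End Elimination.

Lemma map_elim_poly (S S' : comNzRingType) (f : {rmorphism S -> S'}) d p qs :
  map_poly f (elim_poly d p qs) = elim_poly d (map_poly f p) (map (map_poly f) qs).
Proof.
rewrite /elim_poly -det_map_mx map_sylv; congr (\det (sylv _ _ _)).
  rewrite -!map_poly_comp; apply: eq_map_poly => c /=; exact: map_polyC.
rewrite /pencil size_map rmorph_sum; apply: eq_bigr => j _ /=.
rewrite map_polyZ /= map_polyXn (nth_map 0) // -!map_poly_comp; congr (_ *: _).
apply: eq_map_poly => c /=; exact: map_polyC.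
Qed.

(** At a parameter [t] the determinant detects a common root of [p] and the member [qt t] of the
    pencil. If no root of [p] kills all of [qs], each [Q b] is a nonzero polynomial in [t], and a
    nonroot of their product is a parameter without common root. *)
Lemma elim_poly_eq0 (L : closedFieldType) d (p : {poly L}) (qs : seq {poly L}) :
  size p = d.+1 -> (forall q, q \in qs -> (size q <= d.+1)%N) ->
  (elim_poly d p qs = 0) <->
  (exists2 b, root p b & forall q, q \in qs -> root q b).
Proof.
move=> sp sqs.
pose qt t := \sum_(j < size qs) t ^+ j *: qs`_j.
have ev t : (elim_poly d p qs).[t] = \det (sylv d p (qt t)).
  rewrite -[LHS]/(horner_eval t _) -det_map_mx map_sylv.
  have idP (r : {poly L}) : map_poly (horner_eval t) (map_poly polyC r) = r.
    rewrite -map_poly_comp; apply: map_poly_id => c _ /=.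
    by rewrite /horner_eval hornerC.
  rewrite idP; congr (\det (sylv _ _ _)).
  rewrite /pencil rmorph_sum; apply: eq_bigr => j _ /=.
  by rewrite map_polyZ idP /= /horner_eval hornerXn.
have sqt t : (size (qt t) <= d.+1)%N.
  apply: leq_trans (size_sum _ _ _) _; apply/bigmax_leqP => j _.
  by apply: leq_trans (size_scale_leq _ _) _; rewrite sqs ?mem_nth.
have qtE b t : (qt t).[b] = (\poly_(j < size qs) (qs`_j).[b]).[t].
  rewrite horner_poly horner_sum; apply: eq_bigr => j _.
  by rewrite hornerZ mulrC.
split=> [E|[b pb qb]]; last first.
  apply/eqP; apply: contraTT isT => /closed_nonrootP[t].
  rewrite /root ev => /negP[]; apply/det_sylv_eq0 => //; exists b => //.
  rewrite /root qtE horner_poly big1 // => j _.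
  by rewrite (rootP (qb _ (mem_nth _ _))) // mul0r.
have [rs pE] := closed_field_poly_normal p.
pose Q b := \poly_(j < size qs) (qs`_j).[b].
have [/hasP[b brs /eqP Qb]|/hasPn nz] := boolP (has (fun b => Q b == 0) rs).
  exists b.
    rewrite pE rootZ ?lead_coef_eq0 -?size_poly_gt0 ?sp //.
    by rewrite root_prod_XsubC.
  move=> q /(nthP 0)[j js <-].
  by have := congr1 (fun r : {poly L} => r`_j) Qb; rewrite coef_poly js coef0 => /eqP.
have /closed_nonrootP[t] : \prod_(b <- rs) Q b != 0.
  by rewrite prodf_seq_neq0; apply/allP => b /nz.
have : (\det (sylv d p (qt t)) == 0) by rewrite -ev E horner0.
case/det_sylv_eq0 => // b pb qb /negP[].
have brs : b \in rs.
  move: pb; rewrite {1}pE rootZ ?lead_coef_eq0 -?size_poly_gt0 ?sp //.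
  by rewrite root_prod_XsubC.
rewrite (big_rem _ brs) /= rootM /root.
by rewrite /Q -qtE (rootP qb) eqxx.
Qed.

(** * Zeros of homogeneous systems by successive projection *)

Definition ext_pt (T : Type) m (a : 'I_m -> T) (b : T) : 'I_m.+1 -> T :=
  fun i => if unlift ord_max i is Some j then a j else b.

Lemma mmap_eq_pt (R S : nzRingType) m (f : R -> S) (x y : 'I_m -> S) g :
  x =1 y -> mmap f x g = mmap f y g.
Proof. by move=> xy; apply: eq_bigr => b _; rewrite (mmap1_eq b xy). Qed.

Lemma widen_lift m (i : 'I_m) : widen_ord (leqnSn m) i = lift ord_max i.
Proof. by apply: val_inj; rewrite /= /bump leqNgt ltn_ord. Qed.

Lemma ext_pt_widen (T : Type) m (a : 'I_m -> T) b i :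
  ext_pt a b (widen_ord (leqnSn m) i) = a i.
Proof. by rewrite /ext_pt widen_lift liftK. Qed.

Lemma ext_pt_max (T : Type) m (a : 'I_m -> T) b : ext_pt a b ord_max = b.
Proof. by rewrite /ext_pt unlift_none. Qed.

Lemma ext_ptE (T : Type) m (x : 'I_m.+1 -> T) :
  ext_pt (fun i => x (widen_ord (leqnSn m) i)) (x ord_max) =1 x.
Proof.
move=> i; rewrite /ext_pt; case: unliftP => [j ->|->] //.
by rewrite widen_lift.
Qed.

Section Muni.
Variables (R : comNzRingType) (m : nat).
Implicit Type g : {mpoly R[m.+1]}.

Lemma muni_eval (L : comNzRingType) (f : {rmorphism R -> L}) a b g :
  (map_poly (mmap f a) (muni g)).[b] = mmap f (ext_pt a b) g.
Proof.
rewrite muniE rmorph_sum horner_sum; apply: eq_bigr => k _ /=.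
rewrite -mul_polyC rmorphM /= map_polyC map_polyXn hornerM hornerC hornerXn /=.
rewrite mmapZ mmapX -mulrA; congr (_ * _); rewrite /mmap1 big_ord_recr /= ext_pt_max.
by congr (_ * _); apply: eq_bigr => i _; rewrite ext_pt_widen mnmE.
Qed.

Lemma muni_homog d g k : g \is d.-homog -> (k <= d)%N -> (muni g)`_k \is (d - k).-homog.
Proof.
move=> /dhomogP hg kd; rewrite muniE coef_sum big_seq rpred_sum // => b bg.
rewrite coefZ coefXn; case: eqP => [kb|_]; last by rewrite mulr0 rpred0.
rewrite mulr1; apply: dhomogZ; rewrite dhomogX /= mdegE.
have := hg _ bg; rewrite /= mdegE big_ord_recr /= -kb => <-; rewrite addnK.
by apply/eqP/eq_bigr => i _; rewrite mnmE.
Qed.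

Lemma size_muni_homog d g : g \is d.-homog -> (size (muni g) <= d.+1)%N.
Proof.
move=> /dhomogP hg; apply/leq_sizeP => k dk; rewrite muniE coef_sum big_seq big1 // => b bg.
rewrite coefZ coefXn; case: eqP => [kb|_]; last by rewrite mulr0.
have := hg _ bg; rewrite /= mdegE big_ord_recr /= -kb => E.
by move: dk; rewrite -E ltnNge leq_addl.
Qed.

(** The coefficient of the [d]-th power of the last variable. Where it is nonzero, the form avoids
    the point [(0 : ... : 0 : 1)] and has exact degree [d] on every fibre of the projection from
    that point. *)
Definition lead_last d g : R := ((muni g)`_d)@_0.

Lemma coef_muni_lead d g : g \is d.-homog -> (muni g)`_d = (lead_last d g)%:MP.
Proof.
move=> hg; apply: msize1_polyC; have := muni_homog hg (leqnn d).
rewrite subnn => /dhomogP h0; rewrite msizeE; apply/bigmax_leqP_seq => b bg _.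
by rewrite h0.
Qed.

Lemma lead_last_eval (L : comNzRingType) (f : {rmorphism R -> L}) d g b :
  g \is d.-homog -> mmap f (ext_pt (fun=> 0) b) g = f (lead_last d g) * b ^+ d.
Proof.
move=> hg; rewrite -muni_eval.
rewrite (@horner_coef_wide _ d.+1); last first.
  by apply: leq_trans (size_poly _ _) (size_muni_homog hg).
rewrite big_ord_recr big1 /= => [|k _]; last first.
  rewrite coef_map /=; have := muni_homog hg (ltnW (ltn_ord k)).
  move=> /dhomogP hk; rewrite /mmap big_seq big1 ?mul0r // => c /hk /= mc.
  rewrite /mmap1; have [i ci] : exists i, c i != 0%N.
    apply/existsP; rewrite -negb_forall; apply/negP => /forallP c0.
    have := ltn_ord k; rewrite -subn_gt0 -mc mdegE big1 // => i _; exact/eqP/c0.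
  by rewrite (bigD1 i) //= expr0n (negbTE ci) mul0r mulr0.
by rewrite add0r coef_map /= coef_muni_lead // mmapC.
Qed.

Lemma size_map_muni (L : idomainType) (f : {rmorphism R -> L}) a d g :
  g \is d.-homog -> f (lead_last d g) != 0 ->
  size (map_poly (mmap f a) (muni g)) = d.+1.
Proof.
move=> hg c0; apply/eqP; rewrite eqn_leq; apply/andP; split.
  by apply: leq_trans (size_poly _ _) (size_muni_homog hg).
rewrite ltnNge; apply: contra c0 => /leq_sizeP/(_ d (leqnn d)).
by rewrite coef_map /= coef_muni_lead // mmapC => ->.
Qed.

Definition coefs_homog d (P : {poly {mpoly R[m]}}) := forall k, P`_k \is d.-homog.

Lemma coefs_homog0 d : coefs_homog d 0.
Proof. by move=> k; rewrite coef0 rpred0. Qed.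

Lemma coefs_homogM d e P Q : coefs_homog d P -> coefs_homog e Q ->
  coefs_homog (d + e) (P * Q).
Proof. by move=> hP hQ k; rewrite coefM rpred_sum // => i _; apply: dhomogM. Qed.

Definition elim_forms d (g : {mpoly R[m.+1]}) gs : seq {mpoly R[m]} :=
  elim_poly d (muni g) [seq muni h | h <- gs].

(** Entry [(i, k)] of the Sylvester matrix has degree [d + rho i - k], with [rho i] the shift of its
    row. With [T] the sum of the numbers below [d], every permutation gives
    [(2 d ^ 2 + 2 T) - (d ^ 2 + 2 T)]. *)
Lemma elim_forms_homog d g (gs : seq {mpoly R[m.+1]}) :
  g \is d.-homog -> (forall h, h \in gs -> h \is d.-homog) ->
  forall h, h \in elim_forms d g gs -> h \is (d ^ 2).-homog.
Proof.
move=> hg hgs h /(nthP 0)[k _ <-]; move: k.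
rewrite -[forall k, _]/(coefs_homog (d ^ 2) (elim_poly d (muni g) _)).
pose M := sylv d (map_poly polyC (muni g)) (pencil [seq muni h | h <- gs]).
pose rho (i : 'I_(d + d)) : nat := match split i with inl j => j | inr j => j end.
have muniP (r : {mpoly R[m.+1]}) e : r \is d.-homog ->
    if (e <= d)%N then is_true ((muni r)`_e \is (d - e).-homog) else (muni r)`_e = 0.
  move=> hr; case: leqP => [|de]; first exact: muni_homog.
  by rewrite nth_default //; apply: leq_trans (size_muni_homog hr) de.
have entry (i k : 'I_(d + d)) :
    if (k <= d + rho i)%N then coefs_homog (d + rho i - k) (M i k) else M i k = 0.
  rewrite /M /sylv mxE /rho; case: (split i) => j; rewrite coefMXn.
    case: (ltnP k j) => kj; first by case: ifP => // _; exact (coefs_homog0 _).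
    rewrite coef_map /=; have := muniP g (k - j)%N hg.
    have -> : (k - j <= d)%N = (k <= d + j)%N by rewrite leq_subLR addnC.
    have -> : (d - (k - j) = d + j - k)%N by lia.
    by case: ifP => [_ H l|_ ->] //; rewrite coefC; case: ifP => // _; rewrite rpred0.
  case: (ltnP k j) => kj; first by case: ifP => // _; exact (coefs_homog0 _).
  have E : (pencil [seq muni h | h <- gs])`_(k - j) =
      \sum_(l < size gs) 'X^l * ((muni gs`_l)`_(k - j))%:P.
    rewrite /pencil size_map coef_sum; apply: eq_bigr => l _.
    by rewrite coefZ coef_map /= (nth_map 0).
  rewrite E; case: ifP => kd.
    move=> e; rewrite coef_sum rpred_sum // => l _.
    rewrite coefMC coefXn; have := muniP gs`_l (k - j)%N (hgs _ (mem_nth 0 (ltn_ord l))).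
    have -> : (k - j <= d)%N by rewrite leq_subLR addnC.
    have -> : (d - (k - j) = d + j - k)%N by lia.
    by case: eqP; rewrite ?mul1r ?mul0r ?rpred0.
  rewrite big1 // => l _; have := muniP gs`_l (k - j)%N (hgs _ (mem_nth 0 (ltn_ord l))).
  have -> : (k - j <= d)%N = false by rewrite leq_subLR addnC.
  by move=> ->; rewrite mulr0.
have prodP (I : finType) (e : I -> nat) (P : I -> {poly {mpoly R[m]}}) :
    (forall i, coefs_homog (e i) (P i)) -> coefs_homog (\sum_i e i) (\prod_i P i).
  move=> H; elim/big_rec2: _ => [|i Q f _ IH]; last exact: coefs_homogM.
  by move=> l; rewrite coef1; case: eqP => _; rewrite ?dhomog1 ?rpred0.
rewrite /elim_poly -/M /determinant => k; rewrite coef_sum rpred_sum // => s _.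
rewrite mulr_sign.
suff H : coefs_homog (d ^ 2) (\prod_i M i (s i)).
  by case: (s : bool); rewrite ?coefN ?rpredN H.
(* An entry outside the band is zero and kills the term; otherwise no natural subtraction truncates
   and the degrees add up. *)
have [/forallP ok|/forallPn[i ki]] := boolP [forall i, s i <= d + rho i]%N; last first.
  have := entry i (s i); rewrite (negbTE ki) => M0.
  by rewrite (bigD1 i) //= M0 mul0r; exact (coefs_homog0 _).
have -> : (d ^ 2 = \sum_i (d + rho i - s i))%N.
  have E : (\sum_i (d + rho i - s i) + \sum_i s i = \sum_i (d + rho i))%N.
    by rewrite -big_split; apply: eq_bigr => i _ /=; rewrite subnK.
  have E1 : (\sum_i s i = \sum_(i < d + d) i)%N.
    by rewrite [RHS](reindex_inj (@perm_inj _ s)).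
  have E2 : (\sum_(i < d + d) i = \sum_(i < d) i + (d * d + \sum_(i < d) i))%N.
    rewrite big_split_ord /=; congr addn.
    by rewrite big_split /= sum_nat_const card_ord.
  have E3 : (\sum_i (d + rho i) = (d + d) * d + (\sum_(i < d) i + \sum_(i < d) i))%N.
    rewrite big_split /= sum_nat_const card_ord; congr addn.
    rewrite big_split_ord /=; congr addn; apply: eq_bigr => i _; rewrite /rho.
      by rewrite (unsplitK (inl i)).
    by rewrite (unsplitK (inr i)).
  move: E; rewrite E1 E2 E3 expnS expn1; lia.
by apply: prodP => i; have := entry i (s i); rewrite ok.
Qed.

End Muni.

Lemma elim_formsP (R : comNzRingType) m (L : closedFieldType)
    (f : {rmorphism R -> L}) d (g : {mpoly R[m.+1]}) (gs : seq {mpoly R[m.+1]}) (a : 'I_m -> L) :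
  g \is d.-homog -> (forall h, h \in gs -> h \is d.-homog) ->
  f (lead_last d g) != 0 ->
  (forall h, h \in elim_forms d g gs -> mmap f a h = 0) <->
  (exists b, forall h, h \in g :: gs -> mmap f (ext_pt a b) h = 0).
Proof.
move=> hg hgs c0.
have sg := size_map_muni a hg c0.
have sgs q : q \in [seq map_poly (mmap f a) (muni h) | h <- gs] -> (size q <= d.+1)%N.
  by move=> /mapP[h /hgs hh ->]; apply: leq_trans (size_poly _ _) (size_muni_homog hh).
have key := elim_poly_eq0 sg sgs.
have mapE : map_poly (mmap f a) (elim_poly d (muni g) [seq muni h | h <- gs]) =
    elim_poly d (map_poly (mmap f a) (muni g)) [seq map_poly (mmap f a) (muni h) | h <- gs].
  by rewrite map_elim_poly -map_comp.
split=> [H|[b bP]].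
  have [|b pb qb] := key.1.
    rewrite -mapE; apply/polyP => k; rewrite coef_map coef0 /=.
    set P := elim_poly _ _ _ in H *; have [kP|Pk] := ltnP k (size P).
      by apply: H; rewrite /elim_forms -/P mem_nth.
    by rewrite nth_default // mmap0.
  exists b => h; rewrite inE => /predU1P[->|hgs']; first by rewrite -muni_eval (rootP pb).
  by rewrite -muni_eval; apply/rootP/qb/map_f.
have E0 : map_poly (mmap f a) (elim_poly d (muni g) [seq muni h | h <- gs]) = 0.
  rewrite mapE; apply/key; exists b; first by rewrite /root muni_eval bP ?mem_head.
  by move=> _ /mapP[h hgs' ->]; rewrite /root muni_eval bP // inE hgs' orbT.
move=> h /(nthP 0)[k _ <-].
by have := congr1 (fun q : {poly L} => q`_k) E0; rewrite coef_map coef0.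
Qed.

Definition common_zero (R : comNzRingType) m (L : fieldType) (f : R -> L)
    (F : seq {mpoly R[m]}) (x : 'I_m -> L) := forall h, h \in F -> mmap f x h = 0.

(** The main theorem of elimination theory, one variable at a time. Over [L1] some form avoids
    [(0 : ... : 0 : 1)]; its leading coefficient, an element of [R], stays nonzero in [L2], so the
    same eliminated forms describe the projection over both fields. *)
Lemma no_zero_transfer (R : comNzRingType) (L1 L2 : closedFieldType)
    (f1 : {rmorphism R -> L1}) (f2 : {rmorphism R -> L2}) m d
    (F : seq {mpoly R[m]}) :
  (forall c, f1 c != 0 -> f2 c != 0) ->
  (forall h, h \in F -> h \is d.-homog) ->
  (forall x, common_zero f1 F x -> forall i, x i = 0) ->
  forall x, common_zero f2 F x -> forall i, x i = 0.
Proof.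
move=> f12; elim: m d F => [|m IH] d F hF H1 x xF; first by case.
have [g gF gP] : exists2 g, g \in F & f1 (lead_last d g) != 0.
  apply: contrapT => H.
  have /H1/(_ ord_max) : common_zero f1 F (ext_pt (fun=> 0) 1).
    move=> h hh; rewrite (lead_last_eval _ _ (hF h hh)) expr1n mulr1.
    by apply/eqP; apply/negP => /negP c0; apply: H; exists h.
  by rewrite ext_pt_max => /eqP; rewrite oner_eq0.
have hg := hF g gF.
have P1 := elim_formsP _ hg hF gP; have P2 := elim_formsP _ hg hF (f12 _ gP).
have subF (L : closedFieldType) (f : {rmorphism R -> L}) y :
    common_zero f F y -> forall h, h \in g :: F -> mmap f y h = 0.
  by move=> yF h; rewrite inE => /predU1P[->|]; apply: yF.
have H1' a : common_zero f1 (elim_forms d g F) a -> forall i, a i = 0.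
  case/P1 => b bP i.
  have := H1 (ext_pt a b) _ (widen_ord (leqnSn m) i); rewrite ext_pt_widen; apply.
  by move=> h hh; apply: bP; rewrite inE hh orbT.
pose a i := x (widen_ord (leqnSn m) i).
have a0 : forall i, a i = 0.
  apply: (IH _ _ (elim_forms_homog hg hF) H1'); apply/P2; exists (x ord_max).
  by move=> h hh; rewrite (mmap_eq_pt _ _ (ext_ptE x)); apply: subF.
have xE : x =1 ext_pt (fun=> 0) (x ord_max).
  by move=> i; rewrite -[LHS]ext_ptE /ext_pt; case: unlift.
have xm : x ord_max = 0.
  have := xF g gF; rewrite (mmap_eq_pt _ _ xE) (lead_last_eval _ _ hg) => /eqP.
  by rewrite mulf_eq0 (negbTE (f12 _ gP)) expf_eq0 => /andP[_ /eqP].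
by move=> i; rewrite xE /ext_pt; case: unlift.
Qed.

(** Projection squares the degree, and above each projected zero there are [d] candidates. The
    factor [d] in the bound closes the induction: [size Z * d] becomes [d ^ 2] times the number of
    projected zeros. The hypothesis at [x ord0 = 0] is inherited, and provides a form avoiding the
    centre of projection, which lies there. *)
Lemma finitely_many_zeros (R : comNzRingType) (L : closedFieldType)
    (f : {rmorphism R -> L}) m d (F : seq {mpoly R[m.+1]}) : (0 < d)%N ->
  (forall h, h \in F -> h \is d.-homog) ->
  (forall x, common_zero f F x -> x ord0 = 0 -> forall i, x i = 0) ->
  exists Z : seq {ffun 'I_m.+1 -> L}, (size Z * d <= d ^ (2 ^ m))%N /\
    forall x, common_zero f F x -> x ord0 = 1 -> exists2 z, z \in Z & x =1 z.
Proof.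
elim: m d F => [|m IH] d F d0 hF H.
  exists [:: [ffun=> 1]]; rewrite /= mul1n expn1; split=> // x _ x0.
  by exists [ffun=> 1]; [rewrite mem_head|move=> i; rewrite ord1 ffunE].
have [g gF gP] : exists2 g, g \in F & f (lead_last d g) != 0.
  apply: contrapT => nex.
  have : common_zero f F (ext_pt (fun=> 0) 1).
    move=> h hh; rewrite (lead_last_eval _ _ (hF h hh)) expr1n mulr1.
    by apply/eqP; apply/negP => /negP c0; apply: nex; exists h.
  have z0 : ext_pt (fun=> 0) (1 : L) (ord0 : 'I_m.+2) = 0.
    by rewrite /ext_pt; case: unliftP => [j _|/(congr1 val)].
  move=> cz; have := H _ cz z0 ord_max; rewrite ext_pt_max => /eqP.
  by rewrite oner_eq0.
have hg := hF g gF; have P := elim_formsP _ hg hF gP.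
have H' a : common_zero f (elim_forms d g F) a -> a ord0 = 0 -> forall i, a i = 0.
  case/P => b bP a0 i.
  have := H (ext_pt a b) _ _ (widen_ord (leqnSn m.+1) i); rewrite ext_pt_widen; apply.
    by move=> h hh; apply: bP; rewrite inE hh orbT.
  have -> : ord0 = widen_ord (leqnSn m.+1) ord0 by apply: val_inj.
  by rewrite ext_pt_widen.
have dd0 : (0 < d ^ 2)%N by rewrite expn_gt0 d0.
have [Z [sZ ZP]] := IH (d ^ 2)%N _ dd0 (elim_forms_homog hg hF) H'.
pose rts a := sval (closed_field_poly_normal (map_poly (mmap f a) (muni g))).
have rtsP a : map_poly (mmap f a) (muni g) = lead_coef (map_poly (mmap f a) (muni g)) *:
    \prod_(z <- rts a) ('X - z%:P) by rewrite /rts; case: closed_field_poly_normal.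
have pz a : lead_coef (map_poly (mmap f a) (muni g)) != 0.
  by rewrite lead_coef_eq0 -size_poly_gt0 (size_map_muni _ hg gP).
have szr a : size (rts a) = d.
  apply/eqP; rewrite -eqSS -(size_map_muni a hg gP) rtsP size_scale //.
  by rewrite size_prod_XsubC.
pose lifts (a : {ffun 'I_m.+1 -> L}) := [seq [ffun i => ext_pt a b i] | b <- rts a].
exists (flatten [seq lifts a | a <- Z]); split.
  have -> : size (flatten [seq lifts a | a <- Z]) = (size Z * d)%N.
    elim: (Z) => //= a Z' IHZ; rewrite size_cat IHZ size_map szr mulSn; lia.
  by move: sZ; rewrite -expnM -expnS -mulnA; lia.
move=> x xF x0; pose a i := x (widen_ord (leqnSn m.+1) i).
have [||z zZ az] := ZP a.
- apply/P; exists (x ord_max) => h; rewrite inE (mmap_eq_pt _ _ (ext_ptE x)).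
  by case/predU1P => [->|]; apply: xF.
- by rewrite -x0; congr x; apply: val_inj.
exists [ffun i => ext_pt z (x ord_max) i]; last first.
  by move=> i; rewrite -[LHS]ext_ptE ffunE /ext_pt; case: unlift.
apply/flattenP; exists [seq [ffun i => ext_pt z b i] | b <- rts z].
  by apply: map_f.
apply: map_f; suff : root (map_poly (mmap f z) (muni g)) (x ord_max).
  by rewrite rtsP rootZ // root_prod_XsubC.
apply/rootP; rewrite muni_eval -[RHS](xF g gF); apply: mmap_eq_pt => i.
by rewrite -[RHS]ext_ptE /ext_pt; case: unlift => // j; rewrite -az.
Qed.

(** * Forms and their critical points *)

Definition expo_mnm n d (a : expo n d) : 'X_{1..n.+1} := bmnm (val a).

Lemma mdeg_expo n d (a : expo n d) : mdeg (expo_mnm a) = d.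
Proof. exact/eqP/(valP a). Qed.

Lemma expo_mnm_inj n d : injective (@expo_mnm n d).
Proof. by move=> a b /val_inj /val_inj. Qed.

Lemma expo_of_mnm n d (b : 'X_{1..n.+1}) : mdeg b = d -> exists a : expo n d, expo_mnm a = b.
Proof.
move=> bd; have bd1 : (mdeg b < d.+1)%N by rewrite bd.
have bdE : mdeg (bmnm (BMultinom bd1)) == d by apply/eqP.
by exists (exist _ (BMultinom bd1) bdE).
Qed.

Definition sgn (V : zmodType) (b : bool) (x : V) : V := if b then - x else x.

Definition form_val (K : fieldType) n d (e : signs n d) (x : 'I_n.+1 -> K) : K :=
  \sum_a sgn (e a) (mon x (expo_mnm a)).

Definition part_val (K : fieldType) n d (e : signs n d) i (x : 'I_n.+1 -> K) : K :=
  \sum_a sgn (e a) ((expo_mnm a i)%:R * mon x (expo_mnm a - U_(i))%MM).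

Lemma sgn_exp (R : nzRingType) (V : lmodType R) (b : bool) (x : V) : (-1) ^+ b *: x = sgn b x.
Proof. by case: b; rewrite ?expr0 ?scale1r // expr1 scaleN1r. Qed.

Lemma sgnM (R : nzRingType) b (c x : R) : c * sgn b x = sgn b (c * x).
Proof. by case: b => //=; rewrite mulrN. Qed.

Lemma sgn0 (V : zmodType) b : sgn b (0 : V) = 0.
Proof. by case: b => //=; rewrite oppr0. Qed.

Lemma raddf_sgn (U V : zmodType) (f : {additive U -> V}) b x : f (sgn b x) = sgn b (f x).
Proof. by case: b => //=; rewrite raddfN. Qed.

Lemma mderiv_sgn (R : nzRingType) n i b (p : {mpoly R[n]}) :
  mderiv i (sgn b p) = sgn b (mderiv i p).
Proof. by case: b => //=; rewrite mderivN. Qed.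

(** The common source over the integers of the form in all characteristics. *)
Definition int_form n d (e : signs n d) : {mpoly int[n.+1]} :=
  \sum_a sgn (e a) 'X_[expo_mnm a].

Lemma mmap_deriv_form (K : fieldType) n d (e : signs n d) i (x : 'I_n.+1 -> K) :
  mmap intr x (mderiv i (int_form e)) = part_val e i x.
Proof.
rewrite /int_form /part_val [mderiv i _]raddf_sum raddf_sum. apply: eq_bigr => a _ /=.
rewrite mderiv_sgn mderivX raddf_sgn /= mmapZ mmapX; congr (sgn _ (_ * _)).
by rewrite rmorph_nat.
Qed.

Lemma mdeg_subU n (b : 'X_{1..n}) i : (0 < b i)%N -> mdeg (b - U_(i))%MM = (mdeg b).-1.
Proof.
move=> bi; have le : (U_(i) <= b)%MM by apply/mnm_lepP => j; rewrite mnm1E; case: eqP => [<-|].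
by rewrite -{2}(submK le) mdegD mdeg1 addn1.
Qed.

Lemma deriv_form_homog n d (e : signs n d) i : mderiv i (int_form e) \is d.-1.-homog.
Proof.
rewrite /int_form [mderiv i _]raddf_sum rpred_sum // => a _ /=.
rewrite mderiv_sgn mderivX.
suff H : (expo_mnm a i)%:R *: 'X_[int, expo_mnm a - U_(i)] \is d.-1.-homog.
  by case: (e a); rewrite /sgn ?rpredN H.
have [->|ai] := posnP (expo_mnm a i); first by rewrite scale0r rpred0.
by apply: dhomogZ; rewrite dhomogX /= mdeg_subU // mdeg_expo.
Qed.

Lemma eq_mon (K : fieldType) n (x y : 'I_n -> K) b : x =1 y -> mon x b = mon y b.
Proof. by move=> xy; apply: eq_bigr => i _; rewrite xy. Qed.

Section PartVal.
Variables (K : fieldType) (n d : nat).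
Implicit Types (e : signs n d) (x : 'I_n.+1 -> K).

Lemma mul_part_val e i x :
  x i * part_val e i x = \sum_a sgn (e a) ((expo_mnm a i)%:R * mon x (expo_mnm a)).
Proof. by rewrite mulr_sumr; apply: eq_bigr => a _; rewrite sgnM monU. Qed.

Lemma euler_form e x : \sum_i x i * part_val e i x = d%:R * form_val e x.
Proof.
under eq_bigr do rewrite mul_part_val.
rewrite exchange_big mulr_sumr; apply: eq_bigr => a _ /=.
rewrite sgnM; case: (e a) => /=; rewrite ?sumrN -mulr_suml -natr_sum -mdegE mdeg_expo //.
Qed.

Definition critical e x := forall i, part_val e i x = 0.

Lemma critical_form_val e x : d%:R != 0 :> K -> critical e x -> form_val e x = 0.
Proof.
move=> d0 cx; apply: (mulfI d0); rewrite mulr0 -euler_form big1 // => i _.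
by rewrite cx mulr0.
Qed.

Lemma eq_part_val e i x y : x =1 y -> part_val e i x = part_val e i y.
Proof. by move=> xy; apply: eq_bigr => a _; rewrite (eq_mon _ xy). Qed.

Lemma mon_scale c x b : mon (fun i => c * x i) b = c ^+ mdeg b * mon x b.
Proof.
rewrite /mon; under eq_bigr do rewrite exprMn.
by rewrite big_split /= mdegE prodrXr.
Qed.

Lemma part_val_scale c e i x :
  part_val e i (fun j => c * x j) = c ^+ d.-1 * part_val e i x.
Proof.
rewrite /part_val mulr_sumr; apply: eq_bigr => a _; rewrite sgnM mon_scale.
have [->|ai] := posnP (expo_mnm a i); first by rewrite !mul0r mulr0.
rewrite mdeg_subU // mdeg_expo.
by rewrite mulrCA.
Qed.

Lemma critical_scale c e x : critical e x -> critical e (fun j => c * x j).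
Proof. by move=> cx i; rewrite part_val_scale cx mulr0. Qed.

Definition degenerate e := exists2 x, (exists i, x i != 0) & critical e x.

End PartVal.

(** * Uniform probability *)

Section UniformProb.
Variable R : realType.
Local Notation pr := (uniform_prob R).

Lemma uniform_probE (T : finType) (E : T -> Prop) :
  pr E = (\sum_t `[< E t >]%:R) / #|T|%:R.
Proof.
rewrite /uniform_prob -sum1_card natr_sum big_mkcond; congr (_ / _).
by apply: eq_bigr => t _; rewrite inE; case: asbool.
Qed.

Lemma uniform_prob_le1 (T : finType) (E : T -> Prop) : pr E <= 1.
Proof.
rewrite /uniform_prob; have [T0|T0] := posnP #|T|.
  by rewrite T0 invr0 mulr0.
by rewrite ler_pdivrMr ?ltr0n // mul1r ler_nat max_card.
Qed.

Lemma uniform_prob_le (T : finType) (E F : T -> Prop) : (forall t, E t -> F t) -> pr E <= pr F.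
Proof.
move=> EF; rewrite ler_wpM2r ?invr_ge0 // ler_nat subset_leq_card //.
by apply/subsetP => t; rewrite !inE => /asboolP /EF /asboolP.
Qed.

Lemma uniform_prob_or (T : finType) (E F : T -> Prop) :
  pr (fun t => E t \/ F t) <= pr E + pr F.
Proof.
rewrite -mulrDl ler_wpM2r ?invr_ge0 // -natrD ler_nat.
apply: leq_trans (leq_card_setU _ _); rewrite subset_leq_card //.
by apply/subsetP => t; rewrite !inE => /asboolP[] /asboolP ->; rewrite ?orbT.
Qed.

Lemma uniform_prob_exists (T : finType) (J : Type) (s : seq J) (E : J -> T -> Prop)
    (F : T -> Prop) :
  (forall t, F t -> exists2 k, (k < size s)%N & forall j0, E (nth j0 s k) t) ->
  pr F <= \sum_(j <- s) pr (E j).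
Proof.
elim: s F => [|j s IH] F H.
  rewrite big_nil uniform_probE big1 ?mul0r // => t _.
  by case: asboolP => // /H[].
rewrite big_cons.
apply: le_trans (_ : pr (fun t => E j t \/ (F t /\ ~ E j t)) <= _).
  by apply: uniform_prob_le => t Ft; have [Et|nEt] := EM (E j t); [left|right].
apply: le_trans (uniform_prob_or _ _) _; rewrite lerD2l.
apply: IH => t [/H[[|k] ks kP] nE]; first by case: nE; apply: (kP j).
by exists k.
Qed.

Definition mix (I : finType) (H : pred I) (e h : {ffun I -> bool}) : {ffun I -> bool} :=
  [ffun i => if H i then h i else e i].

(** Conditioning on the signs outside [H]. Exchanging the signs in [H] between two independent
    choices permutes the pairs, so redrawing them preserves the probability. *)
Lemma uniform_prob_mix (I : finType) (H : pred I) (E : {ffun I -> bool} -> Prop) B :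
  (forall e, pr (fun h => E (mix H e h)) <= B) -> pr E <= B.
Proof.
move=> HB; pose T : finType := {ffun I -> bool}.
have T0 : #|T|%:R != 0 :> R.
  by rewrite pnatr_eq0 -lt0n; apply/card_gt0P; exists [ffun=> false].
have E1 : \sum_(e : T) pr (fun h => E (mix H e h)) = #|T|%:R * pr E.
  under eq_bigr do rewrite uniform_probE.
  rewrite -mulr_suml pair_bigA uniform_probE mulrA; congr (_ / _).
  pose sw (u : T * T) : T * T := (mix H u.1 u.2, mix H u.2 u.1).
  have swK : involutive sw.
    move=> [e h]; rewrite /sw /=; congr pair; apply/ffunP => i; rewrite !ffunE;
    by case: (H i).
  rewrite (reindex_inj (inv_inj swK)) /=.
  transitivity (\sum_(u : T * T) `[< E u.1 >]%:R : R).
    apply: eq_bigr => -[e h] _ /=; congr (`[< E _ >]%:R).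
    by apply/ffunP => i; rewrite !ffunE; case: (H i).
  rewrite -(pair_bigA _ (fun e h : T => `[< E e >]%:R)) /= mulr_sumr.
  by apply: eq_bigr => e _; rewrite sumr_const mulr_natl.
have : \sum_(e : T) pr (fun h => E (mix H e h)) <= #|T|%:R * B.
  rewrite mulr_natl -sumr_const; exact: ler_sum.
by rewrite E1 ler_pM2l // lt_neqAle eq_sym T0 ler0n.
Qed.

(** Both sides are averaged over all translations by sign vectors on [J], extended to [I]; this
    replaces counting the fibres of the restriction. *)
Lemma uniform_prob_restrict (I J : finType) (g : J -> I) (Q : {ffun J -> bool} -> Prop) :
  injective g -> pr (fun e : {ffun I -> bool} => Q [ffun j => e (g j)]) = pr Q.
Proof.
move=> g_inj; pose T : finType := {ffun I -> bool}; pose U : finType := {ffun J -> bool}.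
have T0 : #|T|%:R != 0 :> R.
  by rewrite pnatr_eq0 -lt0n; apply/card_gt0P; exists [ffun=> false].
have U0 : #|U|%:R != 0 :> R.
  by rewrite pnatr_eq0 -lt0n; apply/card_gt0P; exists [ffun=> false].
pose res (e : T) : U := [ffun j => e (g j)].
pose ext (t : U) : T := [ffun i => if [pick j | g j == i] is Some j then t j else false].
pose xo (S : finType) (a b : {ffun S -> bool}) : {ffun S -> bool} := [ffun i => a i (+) b i].
have xoK (S : finType) (b : {ffun S -> bool}) : involutive (fun a => xo S a b).
  by move=> a; apply/ffunP => i; rewrite !ffunE -addbA addbb addbF.
have res_xo e t : res (xo I e (ext t)) = xo J (res e) t.
  apply/ffunP => j; rewrite !ffunE; case: pickP => [j' /eqP/g_inj -> //|/(_ j)].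
  by rewrite eqxx.
have S1 : \sum_(e : T) \sum_(t : U) `[< Q (xo J t (res e)) >]%:R =
          #|T|%:R * \sum_(t : U) `[< Q t >]%:R :> R.
  rewrite mulr_natl -sumr_const; apply: eq_bigr => e _.
  by rewrite [RHS](reindex_inj (inv_inj (xoK J (res e)))).
have S2 : \sum_(e : T) \sum_(t : U) `[< Q (xo J t (res e)) >]%:R =
          #|U|%:R * \sum_(e : T) `[< Q (res e) >]%:R :> R.
  rewrite exchange_big /= mulr_natl -sumr_const; apply: eq_bigr => t _.
  rewrite [RHS](reindex_inj (inv_inj (xoK I (ext t)))) /=.
  apply: eq_bigr => e _; rewrite res_xo; congr (`[< Q _ >]%:R).
  by apply/ffunP => j; rewrite !ffunE addbC.
by rewrite !uniform_probE; apply/eqP; rewrite eqr_div // mulrC -S2 S1 mulrC.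
Qed.

Definition walk_return (p h : nat) : R := p%:R^-1 + (Num.sqrt h.*2%:R)^-1.

Lemma walk_bound_le p h : (0 < p)%N -> (0 < h)%N ->
  (walk_bound p h)%:R <= walk_return p h * 2 ^+ h.*2.
Proof.
move=> p0 h0.
have p0R : 0 < p%:R :> R by rewrite ltr0n.
have s0 : 0 < Num.sqrt h.*2%:R :> R by rewrite sqrtr_gt0 ltr0n double_gt0.
apply: le_trans (_ : (2 ^+ h.*2 + p%:R * 'C(h.*2, h)%:R) / p%:R <= _).
  by rewrite ler_pdivlMr // -natrM -natrX -natrM -natrD ler_nat leq_divM.
rewrite mulrDl (mulrC p%:R) mulfK ?gt_eqF // mulrDl (mulrC _^-1) lerD2l.
rewrite mulrC ler_pdivlMr //.
rewrite -(@ler_pXn2r _ 2) ?nnegrE ?mulr_ge0 ?exprn_ge0 // ?(ltW s0) //.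
rewrite exprMn sqr_sqrtr ?ler0n // -exprM -!natrX -natrM ler_nat muln2.
apply: leq_trans (bin_mid_sqr_le h); rewrite leq_mul2l; apply/orP; right.
exact: leqnSn.
Qed.

Lemma uniform_prob_signed_sum_le (V : zmodType) (I : finType) (v : I -> V) c p k m
    (L : seq (seq I)) : prime p -> odd p -> (0 < k)%N ->
  uniq (flatten L) -> size L = (2 ^ k)%N ->
  (forall l, l \in L -> size l = m /\ indep_mod p [seq v i | i <- l]) ->
  pr (fun e => signed_sum v e = c) <= (p%:R^-1 + (Num.sqrt (2 ^ k)%:R)^-1) ^+ m.
Proof.
move=> pp op k0 uL sL HL; pose h := (2 ^ k.-1)%N.
have hE : (2 ^ k = h.*2)%N by rewrite /h -[in LHS](prednK k0) expnS mul2n.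
have h0 : (0 < h)%N by rewrite expn_gt0.
have Db a : (count (fun b : int => (p%:Z %| (b - a)%R)%Z)
     (signed_sums (nseq (2 ^ k) (1 : int))) <= walk_bound p h)%N.
  by rewrite hE; apply: count_walk_mod_le.
have C := card_signed_sum_le c Db uL sL HL.
rewrite /uniform_prob card_ffun card_bool ler_pdivrMr ?ltr0n ?expn_gt0 //.
have -> : #|[set t | `[< signed_sum v t = c >]]| = #|[set e | signed_sum v e == c]|.
  by apply: eq_card => e; rewrite !inE; apply/asboolP/eqP.
have W := walk_bound_le (prime_gt0 pp) h0.
rewrite hE -/(walk_return p h).
have P0 : 0 < (2 ^ (m * h.*2))%:R :> R by rewrite ltr0n expn_gt0.
rewrite -(ler_pM2r P0) -natrM.
apply: le_trans (_ : (walk_bound p h ^ m * 2 ^ #|I|)%:R <= _).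
  by rewrite ler_nat -hE.
rewrite natrM mulrAC ler_pM2r ?ltr0n ?expn_gt0 //.
rewrite !natrX mulnC exprM -exprMn; apply: lerXn2r; rewrite ?nnegrE ?ler0n //.
by apply: le_trans W; rewrite ler0n.
Qed.

End UniformProb.

(** * Points of small and of large period *)

Definition affine_mnm n d (a : expo n d) : 'X_{1..n} :=
  [multinom expo_mnm a (lift ord0 i) | i < n].

Lemma affine_mnm_onto n d (b : 'X_{1..n}) : (mdeg b <= d)%N ->
  exists a : expo n d, affine_mnm a = b.
Proof.
move=> bd; pose c : 'X_{1..n.+1} :=
  [multinom if unlift ord0 i is Some j then b j else (d - mdeg b)%N | i < n.+1].
have cd : mdeg c = d.
  rewrite mdegE big_ord_recl mnmE unlift_none.
  under eq_bigr do rewrite mnmE liftK.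
  by rewrite -mdegE subnK.
have [a aE] := expo_of_mnm cd; exists a.
by apply/mnmP => i; rewrite mnmE aE mnmE liftK.
Qed.

Lemma map_onto (S T : Type) (f : S -> T) (P : T -> Prop) (s : seq T) :
  (forall t, P t -> exists u, f u = t) -> (forall k t0, (k < size s)%N -> P (nth t0 s k)) ->
  exists s', [seq f u | u <- s'] = s.
Proof.
move=> H; elim: s => [|t s IH] Ps; first by exists [::].
have [u uE] := H t (Ps 0%N t isT).
have [k t0 ks|s' s'E] := IH; first exact: (Ps k.+1).
by exists (u :: s'); rewrite /= uE s'E.
Qed.

Definition translate n r (i0 : 'I_n) t (b : 'X_{1..n < r}) : 'X_{1..n} :=
  (U_(i0) *+ (r * t) + bmnm b)%MM.

(** Exponents in [l] are below [r], so dividing the exponent at [i0] by [r] recovers the shift [t],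
    and the blocks are disjoint. The factor [q] will be 1 for jets and [p] for [p]-th powers. *)
Lemma translate_blocks n d r k q (i0 : 'I_n) (l : seq 'X_{1..n < r}) :
  uniq l -> (0 < q)%N -> (q * (r * 2 ^ k) <= d)%N ->
  exists L : seq (seq (expo n d)), [/\ uniq (flatten L), size L = (2 ^ k)%N &
    forall B, B \in L -> exists c : 'X_{1..n},
      [seq affine_mnm a | a <- B] = [seq ((c + bmnm b) *+ q)%MM | b <- l]].
Proof.
move=> ul q0 qd.
pose S := [seq [seq (translate i0 t b *+ q)%MM | b <- l] | t <- iota 0 (2 ^ k)].
have tb_inj t t' (b b' : 'X_{1..n < r}) :
    (translate i0 t b *+ q)%MM = (translate i0 t' b' *+ q)%MM -> t = t' /\ b = b'.
  move=> E.
  have Ei i : (U_(i0)%MM i * (r * t) + b i = U_(i0)%MM i * (r * t') + b' i)%N.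
    have := congr1 (fun m : 'X_{1..n} => m i) E.
    rewrite !mulmnE /translate !mnmDE !mulmnE => /eqP.
    by rewrite eqn_pmul2r // => /eqP.
  have br (c : 'X_{1..n < r}) : (c i0 < r)%N.
    apply: leq_ltn_trans (bmdeg c); rewrite mdegE (bigD1 i0) //=; exact: leq_addr.
  have tt' : t = t'.
    have := Ei i0; rewrite mnm1E eqxx !mul1n.
    by have := br b; have := br b'; nia.
  split=> //; apply: val_inj; apply/mnmP => i; have := Ei i.
  by rewrite tt' => /addnI.
have uS : uniq (flatten S).
  apply: (@allpairs_uniq _ _ _ (fun t b => (translate i0 t b *+ q)%MM)) => //.
    exact: iota_uniq.
  by move=> [t b] [t' b'] _ _ /= /tb_inj[-> ->].
have degS s : s \in S -> exists B : seq (expo n d), [seq affine_mnm a | a <- B] = s.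
  move=> /mapP[t]; rewrite mem_iota add0n => tk ->.
  apply: (map_onto (P := fun b => mdeg b <= d)%N); first exact: affine_mnm_onto.
  move=> j b0; rewrite size_map => jl.
  have [b1 _] : exists b1 : 'X_{1..n < r}, true by case: (l) jl => [|b1] // _; exists b1.
  rewrite (nth_map b1) // mdegMn mdegD mdegMn mdeg1 mul1n.
  have := bmdeg (nth b1 l j); move: (mdeg _) => D Dr.
  apply: leq_trans qd; rewrite mulnC leq_mul2l; apply/orP; right; nia.
have [|L LE] := map_onto (f := map (@affine_mnm n d)) (P := fun s => s \in S) (s := S) degS.
  by move=> j t0 jS; apply: mem_nth.
exists L; split.
- apply: (@map_uniq _ _ (@affine_mnm n d)).
  by rewrite map_flatten LE.
- by rewrite -(size_map (map (@affine_mnm n d))) LE size_map size_iota.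
move=> B BL; have : [seq affine_mnm a | a <- B] \in S by rewrite -LE map_f.
by move=> /mapP[t _ ->]; exists (U_(i0) *+ (r * t))%MM.
Qed.

Section CharP.
Variables (R : realType) (K : closedFieldType) (p : nat).
Hypothesis chp : p \in [pchar K].
Hypothesis oddp : odd p.
Variables (n d : nat) (i0 : 'I_n).
Hypothesis d0 : d%:R != 0 :> K.
Local Notation pr := (uniform_prob R).
Implicit Types (e h : signs n d) (y : 'I_n -> K).

Let pp : prime p := pcharf_prime chp.

Definition homogenize y : 'I_n.+1 -> K :=
  fun i => if unlift ord0 i is Some j then y j else 1.

Lemma mon_homogenize y (a : expo n d) :
  mon (homogenize y) (expo_mnm a) = mon y (affine_mnm a).
Proof.
rewrite /mon big_ord_recl /homogenize unlift_none expr1n mul1r.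
by apply: eq_bigr => i _; rewrite liftK mnmE.
Qed.

Lemma critical_jet_vec e y : critical e (homogenize y) ->
  signed_sum (fun a => jet_vec y (affine_mnm a)) e = 0.
Proof.
move=> cy; apply/ffunP => o; rewrite /signed_sum sum_ffunE !ffunE.
have E : \sum_a sgn (e a) (jet y o (affine_mnm a)) = 0.
  case: o => [i|].
    rewrite -[RHS](mulr0 (homogenize y (lift ord0 i))) -[in RHS](cy (lift ord0 i)).
    rewrite mul_part_val; apply: eq_bigr => a _.
    by rewrite mon_homogenize /jet mnmE.
  rewrite -[RHS](critical_form_val d0 cy); apply: eq_bigr => a _.
  by rewrite mon_homogenize /jet mul1r.
rewrite -[RHS]E; apply: eq_bigr => a _.
by case: (e a); rewrite /= !ffunE.
Qed.

Lemma low_period_prob r k y : (forall i, y i != 0) -> no_small_period p r y ->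
  (0 < k)%N -> (r.*2 * 2 ^ k <= d)%N ->
  pr (fun e => critical e (homogenize y)) <=
  (p%:R^-1 + (Num.sqrt (2 ^ k)%:R)^-1) ^+ (r * n.+1).
Proof.
move=> y0 per k0 rd; have [l [ul sl lP]] := indep_jets chp y0 per.
have [|L [uL sL LP]] := translate_blocks (q := 1) i0 ul isT (k := k) (d := d).
  by rewrite mul1n.
apply: le_trans (uniform_prob_le R (@critical_jet_vec ^~ y)) _.
apply: (uniform_prob_signed_sum_le R 0 pp oddp k0 uL sL) => B /LP[c Bc].
split; first by rewrite -sl -(size_map (@affine_mnm n d)) Bc size_map.
rewrite (map_comp (jet_vec y) (@affine_mnm n d)) Bc -map_comp.
have -> : [seq (jet_vec y \o (fun b : 'X_{1..n < r.*2} => ((c + bmnm b) *+ 1)%MM)) b | b <- l]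
        = [seq jet_vec y (c + bmnm b)%MM | b <- l]; last exact: lP.
by apply: eq_map => b /=; congr (jet_vec y _); apply/mnmP => i; rewrite mulmnE muln1.
Qed.

(** Only derivatives other than the one along [x ord0] enter: the signs at [p_power] exponents do
    not affect them, so the condition survives redrawing these signs. *)
Definition infinity_regular e := forall x : 'I_n.+1 -> K, x ord0 = 0 ->
  (forall i, part_val e (lift ord0 i) x = 0) -> forall i, x i = 0.

Definition p_power (a : expo n d) := [forall i, p %| affine_mnm a i]%N.

(* The derivative of a [p]-th power is zero. *)
Lemma part_val_mix e h i (x : 'I_n.+1 -> K) :
  part_val (mix p_power e h) (lift ord0 i) x = part_val e (lift ord0 i) x.
Proof.
apply: eq_bigr => a _; rewrite ffunE; case: ifP => // /forallP/(_ i).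
rewrite mnmE => /dvdnP[m ->].
by rewrite natrM (pcharf0 chp) mulr0 mul0r !sgn0.
Qed.

Lemma high_period_prob r k : (1 < d)%N -> (0 < k)%N -> (p * (r.*2 * 2 ^ k) <= d)%N ->
  pr (fun e => infinity_regular e /\ exists y, [/\ forall i, y i != 0,
        no_small_period p r y & critical e (homogenize y)]) <=
  (d ^ (2 ^ n))%:R * (p%:R^-1 + (Num.sqrt (2 ^ k)%:R)^-1) ^+ r.
Proof.
move=> d1 k0 rd; set B := (_ + _) ^+ r.
have B0 : 0 <= B by rewrite exprn_ge0 // addr_ge0 ?invr_ge0 ?sqrtr_ge0 ?ler0n.
apply: (@uniform_prob_mix R _ p_power) => e.
(* Regularity depends only on the signs that are kept, so for an irregular [e] the conditioned event
   is empty. *)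
have [reg|nreg] := EM (infinity_regular e); last first.
  apply: le_trans (_ : pr (fun _ : signs n d => False) <= _).
    apply: uniform_prob_le => h [reg _]; apply: nreg => x x0 xe.
    by apply: reg => // i; rewrite part_val_mix.
  rewrite uniform_probE big1 ?mul0r ?mulr_ge0 ?ler0n // => h _.
  by case: asboolP.
pose F := [seq mderiv (lift ord0 i) (int_form e) | i <- enum 'I_n].
have hF g : g \in F -> g \is d.-1.-homog.
  by move=> /mapP[i _ ->]; apply: deriv_form_homog.
have zF (x : 'I_n.+1 -> K) : common_zero intr F x <->
    forall i, part_val e (lift ord0 i) x = 0.
  split=> [H i|H g /mapP[i _ ->]]; last by rewrite mmap_deriv_form.
  by rewrite -mmap_deriv_form; apply/H/map_f; rewrite mem_enum.
have [|//|Z [sZ ZP]] := finitely_many_zeros (d := d.-1) (f := intr : {rmorphism int -> K}) _ hF.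
- by case: (d) d1 => [|[]].
- by move=> x /zF xe x0; apply: reg.
have sZd : (size Z <= d ^ (2 ^ n))%N.
  apply: leq_trans (leq_trans _ sZ) _; first by rewrite leq_pmulr //; case: (d) d1 => [|[]].
  by rewrite leq_exp2r ?expn_gt0 // leq_pred.
pose Ez (z : {ffun 'I_n.+1 -> K}) (h : signs n d) := [/\ z ord0 = 1, forall i, z i != 0,
  no_small_period p r (fun i => z (lift ord0 i)) & form_val (mix p_power e h) z = 0].
apply: (@le_trans _ _ (\sum_(z <- Z) pr (Ez z))).
  apply: uniform_prob_exists => h [_ [y [y0 yper ycr]]].
  have [| |z zZ yz] := ZP (homogenize y).
  - by apply/zF => i; rewrite -(part_val_mix _ h).
  - by rewrite /homogenize unlift_none.
  exists (index z Z); first by rewrite index_mem.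
  move=> z0; rewrite nth_index //; split.
  - by rewrite -yz /homogenize unlift_none.
  - by move=> i; rewrite -yz /homogenize; case: unlift => [j|]; rewrite ?oner_neq0.
  - have -> : (fun i => z (lift ord0 i)) = y; last by [].
    by apply/funext => i; rewrite -yz /homogenize liftK.
  rewrite -(critical_form_val d0 ycr); apply: eq_bigr => a _.
  by rewrite (eq_mon _ yz).
apply: (@le_trans _ _ (\sum_(z <- Z) B)); last first.
  by rewrite big_const_seq count_predT iter_addr_0 -[X in X <= _]mulr_natl ler_wpM2r // ler_nat.
apply: ler_sum => z _.
have [[z1 zt zper]|nz] := EM ([/\ z ord0 = 1, forall i, z i != 0 &
  no_small_period p r (fun i => z (lift ord0 i))]); last first.
  apply: le_trans (_ : pr (fun _ : signs n d => False) <= _).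
    by apply: uniform_prob_le => h [z1 z2 z3 _]; apply: nz.
  by rewrite uniform_probE big1 ?mul0r // => h _; case: asboolP.
pose y i := z (lift ord0 i).
have zy : z =1 homogenize y.
  by move=> i; rewrite /homogenize; case: unliftP => [j ->|->].
have [l [ul sl lP]] := indep_mons chp (fun i => zt (lift ord0 i)) zper.
have [|L [uL sL LP]] := translate_blocks (q := p) i0 ul (prime_gt0 pp) (k := k) (d := d).
  exact: rd.
(* The redrawn signs act through [w], and the kept ones contribute the constant [c]. *)
pose w (a : expo n d) : K := if p_power a then mon y (affine_mnm a) else 0.
pose c := \sum_(a | ~~ p_power a) sgn (e a) (mon y (affine_mnm a)).
apply: le_trans (_ : pr (fun h => signed_sum w h = - c) <= _).
  apply: uniform_prob_le => h [_ _ _ hz]; apply/eqP; rewrite -addr_eq0 -hz.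
  apply/eqP; rewrite /form_val [RHS](bigID p_power) /= /signed_sum [X in X + _](bigID p_power) /=.
  rewrite [X in _ + X + _]big1 ?addr0 => [|a na]; last first.
    by rewrite /w (negbTE na); case: (h a); rewrite ?oppr0.
  congr (_ + _); apply: eq_bigr => a pa; rewrite ffunE (eq_mon _ zy) mon_homogenize.
    by rewrite pa /w pa.
  by rewrite (negbTE pa).
apply: (uniform_prob_signed_sum_le R (- c) pp oddp k0 uL sL) => s /LP[c' Bc].
split; first by rewrite -sl -(size_map (@affine_mnm n d)) Bc size_map.
have -> : [seq w a | a <- s] = [seq mon y b | b <- [seq affine_mnm a | a <- s]].
  rewrite -map_comp; apply/eq_in_map => a as_ /=; rewrite /w.
  case: ifP => // /negP[]; apply/forallP => i.
  have : affine_mnm a \in [seq affine_mnm a | a <- s] by apply: map_f.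
  by rewrite Bc => /mapP[b _ ->]; rewrite mulmnE dvdn_mull.
by rewrite Bc -map_comp; apply: lP.
Qed.

End CharP.

(** * Coordinate faces *)

Section Restriction.
Variables (n d : nat) (j : 'I_n.+2).

Definition insert_zero (b : 'X_{1..n.+1}) : 'X_{1..n.+2} :=
  [multinom if unlift j i is Some k then b k else 0%N | i < n.+2].

Lemma mdeg_insert_zero b : mdeg (insert_zero b) = mdeg b.
Proof.
rewrite !mdegE (bigD1_ord j) //= mnmE unlift_none add0n.
by apply: eq_bigr => i _; rewrite mnmE liftK.
Qed.

Definition face_expo (a : expo n d) : expo n.+1 d :=
  sval (cid (expo_of_mnm (etrans (mdeg_insert_zero (expo_mnm a)) (mdeg_expo a)))).

Lemma face_expoE a : expo_mnm (face_expo a) = insert_zero (expo_mnm a).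
Proof. by rewrite /face_expo; case: cid. Qed.

Lemma face_expo_inj : injective face_expo.
Proof.
move=> a b /(congr1 (@expo_mnm _ _)); rewrite !face_expoE => /mnmP E.
by apply/expo_mnm_inj/mnmP => i; have := E (lift j i); rewrite !mnmE liftK.
Qed.

Lemma face_expo_onto (b : expo n.+1 d) : expo_mnm b j = 0%N -> exists a, b = face_expo a.
Proof.
move=> bj; pose c : 'X_{1..n.+1} := [multinom expo_mnm b (lift j i) | i < n.+1].
have cE : insert_zero c = expo_mnm b.
  by apply/mnmP => i; rewrite mnmE; case: unliftP => [k ->|->]; rewrite ?mnmE.
have cd : mdeg c = d by rewrite -mdeg_insert_zero cE mdeg_expo.
have [a aE] := expo_of_mnm cd; exists a.
by apply: expo_mnm_inj; rewrite face_expoE aE cE.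
Qed.

Definition face_signs (e : signs n.+1 d) : signs n d := [ffun a => e (face_expo a)].

Lemma face_part_val (K : fieldType) e i (x : 'I_n.+2 -> K) : x j = 0 ->
  part_val e (lift j i) x = part_val (face_signs e) i (fun k => x (lift j k)).
Proof.
move=> xj; rewrite /part_val (bigID (fun b => b \in [set face_expo a | a : expo n d])) /=.
rewrite [X in _ + X]big1 ?addr0 => [|b nb]; last first.
  rewrite /mon (bigD1 j) //= xj mnmBE mnm1E.
  have -> : (lift j i == j) = false by rewrite eq_sym (negbTE (neq_lift _ _)).
  rewrite subn0 expr0n; case: eqP => [bj|_]; last by rewrite mul0r mulr0 sgn0.
  by have [a bE] := face_expo_onto bj; rewrite bE imset_f in nb.
rewrite big_imset /=; last by move=> a b _ _; apply: face_expo_inj.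
apply: eq_big => [a|a _]; first by rewrite inE.
rewrite ffunE face_expoE mnmE liftK; congr (sgn _ (_ * _)).
rewrite /mon (bigD1_ord j) //= mnmBE mnmE unlift_none sub0n expr0 mul1r.
apply: eq_bigr => k _; rewrite !mnmBE mnmE liftK !mnm1E.
by rewrite (inj_eq (@lift_inj _ j)).
Qed.

Lemma face_degenerate (K : fieldType) e (x : 'I_n.+2 -> K) :
  x j = 0 -> (exists i, x i != 0) -> (forall i, part_val e (lift j i) x = 0) ->
  degenerate K (face_signs e).
Proof.
move=> xj [i xi] xe; exists (fun k => x (lift j k)).
  by case: (unliftP j i) xi => [k ->|->]; [exists k|rewrite xj eqxx].
by move=> k; rewrite -face_part_val.
Qed.

End Restriction.

Lemma form_dim0_nondegenerate (K : fieldType) d (e : signs 0 d) :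
  d%:R != 0 :> K -> ~ degenerate K e.
Proof.
move=> d0 [x [i xi] cx]; have := critical_form_val d0 cx.
have xE (a : expo 0 d) : mon x (expo_mnm a) = x i ^+ d.
  rewrite /mon big_ord1 -{2}(mdeg_expo a) mdegE big_ord1.
  by rewrite (ord1 i).
have [a0 a0E] := @expo_of_mnm 0 d [multinom d | _ < 1]
  (ltac:(by rewrite mdegE big_ord1 mnmE)).
have uniq a : a = a0.
  apply: expo_mnm_inj; apply/mnmP => k; rewrite (ord1 k).
  have D (b : expo 0 d) : expo_mnm b ord0 = d by rewrite -[RHS](mdeg_expo b) mdegE big_ord1.
  by rewrite !D.
rewrite /form_val (bigD1 a0) //= big1 ?addr0 => [|a]; last by rewrite (uniq a) eqxx.
rewrite xE => /eqP; case: (e a0); rewrite ?oppr_eq0 expf_eq0 (negbTE xi) andbF //.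
Qed.

Section FixedPoints.
Variables (R : realType) (K : closedFieldType) (p : nat).
Hypothesis chp : p \in [pchar K].
Hypothesis oddp : odd p.
Variables (n d : nat) (i0 : 'I_n).
Hypothesis d0 : d%:R != 0 :> K.

Lemma fixed_points_enum r : (0 < r)%N -> exists s : seq K,
  size s = (p ^ r)%N /\ forall y, y ^+ (p ^ r) = y -> y \in s.
Proof.
move=> r0; have p1 := prime_gt1 (pcharf_prime chp).
have q1 : (1 < p ^ r)%N by rewrite -(exp1n r) ltn_exp2r.
pose P : {poly K} := 'X^(p ^ r) - 'X.
have sP : size P = (p ^ r).+1.
  by rewrite size_polyDl size_polyXn // size_polyN size_polyX ltnS.
have [s sE] := closed_field_poly_normal P.
have lc : lead_coef P != 0 by rewrite lead_coef_eq0 -size_poly_gt0 sP.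
exists s; split.
  by apply/eqP; rewrite -eqSS -sP sE size_scale // size_prod_XsubC.
move=> y yq; have : root P y by rewrite /root hornerD hornerN hornerXn hornerX yq subrr.
by rewrite sE rootZ // root_prod_XsubC.
Qed.

Lemma low_periods_prob r k : (0 < r)%N -> (0 < k)%N -> (r.*2 * 2 ^ k <= d)%N ->
  uniform_prob R (fun e : signs n d => exists y : 'I_n -> K,
    [/\ forall i, y i != 0, frob_fixed p r y, no_small_period p r y &
        critical e (homogenize y)]) <=
  ((p ^ r) ^ n)%:R * (p%:R^-1 + (Num.sqrt (2 ^ k)%:R)^-1) ^+ (r * n.+1).
Proof.
move=> r0 k0 rd; set B := (_ + _) ^+ _.
have [s [ss sP]] := fixed_points_enum r0.
pose T : finType := {ffun 'I_n -> 'I_(p ^ r)}.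
pose pt (t : T) i := s`_(t i).
pose Et (t : T) (e : signs n d) := [/\ forall i, pt t i != 0,
  no_small_period p r (pt t) & critical e (homogenize (pt t))].
apply: (@le_trans _ _ (\sum_(t <- enum T) uniform_prob R (Et t))).
  apply: uniform_prob_exists => e [y [y0 yf yper yc]].
  have lt i : (index (y i) s < p ^ r)%N.
    by rewrite -ss index_mem; apply/sP/eqP; move/forallP: yf => /(_ i).
  pose t : T := [ffun i => Ordinal (lt i)].
  have tE : pt t = y.
    by apply/funext => i; rewrite /pt ffunE /= nth_index // -index_mem ss.
  exists (index t (enum T)); first by rewrite index_mem mem_enum.
  by move=> t0; rewrite nth_index ?mem_enum // /Et tE; split.
apply: (@le_trans _ _ (\sum_(t <- enum T) B)); last first.
  rewrite big_const_seq count_predT iter_addr_0 -cardE card_ffun !card_ord.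
  by rewrite -[X in X <= _]mulr_natl.
apply: ler_sum => t _.
have [[t0 tper]|nt] := EM ((forall i, pt t i != 0) /\ no_small_period p r (pt t)).
  apply: le_trans (low_period_prob R chp oddp i0 d0 t0 tper k0 rd).
  by apply: uniform_prob_le => e [].
apply: le_trans (_ : uniform_prob R (fun _ : signs n d => False) <= _).
  by apply: uniform_prob_le => e [t1 t2 _]; apply: nt.
rewrite uniform_probE big1 ?mul0r => [|h _]; last by case: asboolP.
by rewrite exprn_ge0 // addr_ge0 ?invr_ge0 ?sqrtr_ge0 ?ler0n.
Qed.

End FixedPoints.

(** * The bound in characteristic p *)

Lemma dyadic_between N m : (0 < N)%N -> (2 * N <= m)%N ->
  exists k, [/\ (0 < k)%N, (N * 2 ^ k <= m)%N & (m < 2 * N * 2 ^ k)%N].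
Proof.
move=> N0 Nm; have q0 : (0 < m %/ N)%N by rewrite divn_gt0 //; lia.
have /andP[lo hi] := trunc_log_bounds (isT : (1 < 2)%N) q0.
exists (trunc_log 2 (m %/ N)); split.
- by rewrite trunc_log_gt0 /= leq_divRL //; lia.
- by rewrite mulnC -leq_divRL.
- by move: hi; rewrite ltn_divLR // expnS mulnAC.
Qed.

Lemma nth_iota1 r N : (0 < r < N)%N ->
  (r.-1 < size (iota 1 N.-1))%N /\ forall j0, nth j0 (iota 1 N.-1) r.-1 = r.
Proof.
by rewrite size_iota => rN; split=> [|j0]; rewrite ?nth_iota; lia.
Qed.

Lemma mem_iota1 r N : r \in iota 1 N.-1 -> (0 < r)%N /\ (r <= N)%N.
Proof. by rewrite mem_iota; lia. Qed.

Lemma inv_sqrt_le (R : realType) (a b c : R) : 0 < a -> 0 < b -> a <= c * b ->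
  (Num.sqrt b)^-1 <= Num.sqrt c / Num.sqrt a.
Proof.
move=> a0 b0 abc; have c0 : 0 <= c by rewrite -(pmulr_lge0 _ b0); lra.
rewrite ler_pdivlMr ?sqrtr_gt0 // mulrC ler_pdivrMr ?sqrtr_gt0 //.
by rewrite -sqrtrM // ler_wsqrtr.
Qed.

(** The smallest period [r] serves both sides of the union bound: the point is one of finitely many
    Frobenius-fixed ones, and its first [r] conjugates are distinct. Regularity at infinity is
    nondegeneracy of the face [ord0]. *)
Lemma degenerate_cases (K : closedFieldType) n d (e : signs n.+1 d) p N :
  degenerate K e ->
  (exists j, degenerate K (face_signs j e)) \/
  (exists2 r, (0 < r < N)%N & exists y : 'I_n.+1 -> K,
    [/\ forall i, y i != 0, frob_fixed p r y, no_small_period p r y &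
        critical e (homogenize y)]) \/
  (infinity_regular K e /\ exists y : 'I_n.+1 -> K,
    [/\ forall i, y i != 0, no_small_period p N y & critical e (homogenize y)]).
Proof.
move=> [x xn cx].
have [|nface] := EM (exists j, degenerate K (face_signs j e)); first by left.
right; have x0 j : x j != 0.
  by apply/eqP => xj; apply: nface; exists j; apply: (face_degenerate xj xn) => i.
pose y i := (x ord0)^-1 * x (lift ord0 i).
have y0 i : y i != 0 by rewrite mulf_neq0 ?invr_eq0.
have cy : critical e (homogenize y).
  have : critical e (fun j => (x ord0)^-1 * x j) by apply: critical_scale.
  move=> cx' i; rewrite -[RHS](cx' i); apply: eq_part_val => j.
  by rewrite /homogenize; case: unliftP => [k ->|->] //; rewrite mulVf.
have [H|nper] := EM (exists r, (0 < r < N)%N && frob_fixed p r y).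
  left; case: (ex_minnP H) => r /andP[rN rf] rmin; exists r => //; exists y.
  split=> // s /andP[s0 sr]; apply/negP => sf.
  have : (r <= s)%N by apply: rmin; rewrite s0 sf andbT; lia.
  by lia.
right; split; last first.
  exists y; split=> // s sN; apply/negP => sf; apply: nper; exists s.
  by rewrite sN.
move=> z z0 ze i; apply/eqP; apply: contrapT => /negP zi.
by apply: nface; exists ord0; apply: (face_degenerate z0 _ ze); exists i.
Qed.

Lemma degenerate_bound (R : realType) (kappa : R) n : 1 <= kappa ->
  exists C, 0 < C /\ forall (d p : nat) (K : closedFieldType),
    p \in [pchar K] -> odd p -> (1 < d)%N -> d%:R != 0 :> K ->
    Num.sqrt d%:R <= p%:R :> R -> p%:R <= kappa * Num.sqrt d%:R ->
    uniform_prob R (fun e : signs n d => degenerate K e) <= C * (Num.sqrt d%:R)^-1.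
Proof.
move=> k1; elim: n => [|n [C [C0 IH]]].
  exists 1; split=> // d p K chp op d1 d0 _ _.
  rewrite uniform_probE big1 ?mul0r ?mul1r ?invr_ge0 ?sqrtr_ge0 // => e _.
  by case: asboolP => // /(form_dim0_nondegenerate d0).
set E := (2 ^ n.+1)%N.
(* [N] is chosen so that [d ^ E * d ^ (- N / 4) = d ^ (- 1 / 2)]; it is kept
   abstract because unfolding it is costly. *)
have [N NE] : exists N, N = (2 * E).+1.*2 by eexists.
(* [A] and [B] absorb the rounding of the number of blocks to a power of 2, from [d < 4 N 2 ^ k] and
   [d < 4 N p 2 ^ k']. The contribution of period [r] is [(G / s) ^ r]: [n.+1] coordinates against
   [n.+2] jet components. *)
pose A : R := 1 + Num.sqrt (4 * N%:R).
pose B : R := 1 + Num.sqrt (4 * N%:R * kappa).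
pose G : R := kappa ^+ n.+1 * A ^+ n.+2.
have A0 : 0 <= A by rewrite addr_ge0 ?sqrtr_ge0.
have B0 : 0 <= B by rewrite addr_ge0 ?sqrtr_ge0.
have kge0 : 0 <= kappa by lra.
have G0 : 0 <= G by rewrite mulr_ge0 ?exprn_ge0.
have N0 : (0 < N)%N by rewrite NE double_gt0.
have N0R : 0 < N%:R :> R by rewrite ltr0n.
pose S : R := \sum_(r < N) G ^+ r.
have S0 : 0 <= S by apply: sumr_ge0 => r _; rewrite exprn_ge0.
have BN0 : 0 <= B ^+ N by rewrite exprn_ge0.
have k4 : 0 < 4 * N%:R * kappa by rewrite !mulr_gt0 //; lra.
(* In order: the [n.+2] faces, the periods below [N], the longer orbits, and the degrees with
   [s < 4 N kappa], where two blocks might not fit but the bound exceeds 1. *)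
exists (n.+2%:R * C + S + B ^+ N + 4 * N%:R * kappa); split.
  by rewrite ltr_wpDl // !addr_ge0 // mulr_ge0 ?ler0n // ltW.
move=> d p K chp op d1 d0 sp ps.
set s := Num.sqrt d%:R in sp ps *.
have dE : s ^+ 2 = d%:R by rewrite sqr_sqrtr ?ler0n.
have s1 : 1 <= s by rewrite -[1]sqrtr1 ler_wsqrtr // ler1n ltnW.
have s0 : 0 < s by lra.
have C2 : 0 <= n.+2%:R * C by rewrite mulr_ge0 ?ler0n ?ltW.
have [small|large] := ltP s (4 * N%:R * kappa).
  apply: le_trans (uniform_prob_le1 _ _) _; rewrite ler_pdivlMr // mul1r; lra.
have d0R : 0 < d%:R :> R by rewrite ltr0n ltnW.
have p0 : (0 < p)%N := prime_gt0 (pcharf_prime chp).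
have p0R : 0 < p%:R :> R by rewrite ltr0n.
have pinv : p%:R^-1 <= s^-1 by rewrite lef_pV2 ?posrE.
have [k [k0 klo khi]] : exists k, [/\ (0 < k)%N, (N.*2 * 2 ^ k <= d)%N & (d < 2 * N.*2 * 2 ^ k)%N].
  apply: dyadic_between; first by rewrite double_gt0.
  rewrite -(ler_nat R) -dE -muln2 !natrM expr2; nra.
have Abound : p%:R^-1 + (Num.sqrt (2 ^ k)%:R)^-1 <= A / s.
  rewrite mulrDl mul1r; apply: lerD pinv _.
  apply: inv_sqrt_le; rewrite ?ltr0n ?expn_gt0 //; first exact: ltnW.
  by rewrite -natrM -natrM ler_nat; apply: leq_trans (ltnW khi) _; rewrite -mul2n mulnA.
have [k' [k'0 k'lo k'hi]] : exists k, [/\ (0 < k)%N, (p * N.*2 * 2 ^ k <= d)%N &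
    (d < 2 * (p * N.*2) * 2 ^ k)%N].
  apply: dyadic_between; first by rewrite muln_gt0 p0 double_gt0.
  rewrite -(ler_nat R) -dE -muln2 !natrM expr2; nra.
have Bbound : p%:R^-1 + (Num.sqrt (2 ^ k')%:R)^-1 <= B / Num.sqrt s.
  rewrite mulrDl mul1r; apply: lerD.
    apply: le_trans pinv _; rewrite lef_pV2 ?posrE ?sqrtr_gt0 //.
    have q1 : 1 <= Num.sqrt s by rewrite -[1]sqrtr1 ler_wsqrtr.
    rewrite -[X in _ <= X](sqr_sqrtr (ltW s0)) expr2 ler_peMl //; lra.
  apply: inv_sqrt_le; rewrite ?ltr0n ?expn_gt0 //.
  have H : d%:R <= 2 * (p%:R * (N%:R * 2)) * (2 ^ k')%:R :> R.
    by rewrite -!natrM muln2 ler_nat ltnW.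
  have T0 : 0 < (2 ^ k')%:R :> R by rewrite ltr0n expn_gt0.
  rewrite -(ler_pM2l s0) -expr2 dE; apply: le_trans H _.
  set T := (2 ^ k')%:R; have := ler_wpM2r (ltW (mulr_gt0 N0R T0)) ps; rewrite -/T; nra.
apply: (@le_trans _ _ (\sum_(j <- enum 'I_n.+2)
    uniform_prob R (fun e => degenerate K (face_signs j e)) +
  (\sum_(r <- iota 1 N.-1) uniform_prob R (fun e : signs n.+1 d => exists y : 'I_n.+1 -> K,
    [/\ forall i, y i != 0, frob_fixed p r y, no_small_period p r y &
        critical e (homogenize y)]) +
   uniform_prob R (fun e : signs n.+1 d => infinity_regular K e /\ exists y : 'I_n.+1 -> K,
    [/\ forall i, y i != 0, no_small_period p N y & critical e (homogenize y)])))).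
  apply: le_trans (uniform_prob_le R (fun e => @degenerate_cases K n d e p N)) _.
  apply: le_trans (uniform_prob_or _ _ _) _; apply: lerD.
    apply: uniform_prob_exists => e [j je]; exists (index j (enum 'I_n.+2)).
      by rewrite index_mem mem_enum.
    by move=> j0; rewrite nth_index ?mem_enum.
  apply: le_trans (uniform_prob_or _ _ _) _; apply: lerD; last exact: lexx.
  apply: uniform_prob_exists => e [r rN ry]; have [sr nr] := nth_iota1 rN.
  by exists r.-1 => // j0; rewrite nr.
have sum_bound (a b c x y z : R) : a <= x / s -> b <= y / s -> c <= z / s ->
    a + (b + c) <= (x + y + z + 4 * N%:R * kappa) / s.
  move=> ax bx cx; apply: le_trans (lerD ax (lerD bx cx)) _.
  rewrite -!mulrDl ler_wpM2r ?invr_ge0 ?(ltW s0) // addrA lerDl; exact: ltW.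
apply: sum_bound; last first.
- apply: le_trans (high_period_prob R chp op ord0 d0 d1 k'0 _) _; first by rewrite mulnA.
  rewrite -/E; apply: le_trans (_ : d%:R ^+ E * (B / Num.sqrt s) ^+ N <= _).
    rewrite natrX ler_wpM2l ?exprn_ge0 ?ler0n // lerXn2r ?nnegrE //.
      by rewrite addr_ge0 ?invr_ge0 ?sqrtr_ge0 ?ler0n.
    by rewrite divr_ge0 ?sqrtr_ge0.
  rewrite expr_div_n mulrCA ler_wpM2l // NE -muln2 mulnC exprM sqr_sqrtr ?(ltW s0) //.
  by rewrite -dE -exprM exprSr invfM mulrA divff ?mul1r // expf_neq0 // gt_eqF.
- rewrite mulr_suml -(big_mkord xpredT (fun r => G ^+ r / s)).
  rewrite big_ltn // ler_wpDl //; first by rewrite expr0 divr_ge0 ?(ltW s0).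
  rewrite -[N in X in _ <= X](prednK N0) /index_iota subSS subn0.
  rewrite big_seq [X in _ <= X]big_seq; apply: ler_sum => r /mem_iota1[r0 rN].
  apply: le_trans (low_periods_prob R chp op ord0 d0 r0 k0 _) _.
    by apply: leq_trans klo; rewrite leq_mul2r leq_double rN orbT.
  apply: le_trans (_ : (kappa * s) ^+ (r * n.+1) * (A / s) ^+ (r * n.+2) <= _).
    apply: ler_pM; rewrite ?ler0n ?exprn_ge0 ?addr_ge0 ?invr_ge0 ?sqrtr_ge0 ?ler0n //.
      rewrite -expnM natrX lerXn2r ?nnegrE ?ler0n //.
      by rewrite mulr_ge0 ?(ltW s0).
    rewrite lerXn2r ?nnegrE ?divr_ge0 ?(ltW s0) // addr_ge0 ?invr_ge0 ?sqrtr_ge0 ?ler0n //.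
  rewrite !(mulnC r) !exprM -exprMn.
  have -> : (kappa * s) ^+ n.+1 * (A / s) ^+ n.+2 = G / s.
    have sn : s ^+ n.+1 != 0 by rewrite expf_neq0 // gt_eqF.
    rewrite exprMn expr_div_n [s ^+ n.+2]exprS /G.
    move: sn (gt_eqF s0); move: (s ^+ n.+1) (kappa ^+ _) (A ^+ _) => x y z x0 sn0.
    by field; rewrite x0 sn0.
  rewrite expr_div_n ler_wpM2l ?exprn_ge0 // lef_pV2 ?posrE ?exprn_gt0 //.
  by rewrite ler_eXnr.
apply: (@le_trans _ _ (\sum_(j <- enum 'I_n.+2) C / s)); last first.
  rewrite big_const_seq count_predT iter_addr_0 -cardE card_ord.
  by rewrite -[X in X <= _]mulr_natl mulrA.
apply: ler_sum => j _.
have := uniform_prob_restrict R (fun e : signs n d => degenerate K e) (@face_expo_inj n d j).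
by rewrite /face_signs => ->; exact: (IH d p K chp op d1 d0 sp ps).
Qed.

(** * Characteristic zero *)

Section Charts.
Variables (K : closedFieldType) (n d : nat) (i : 'I_n.+1).

Definition chart_mnm (b : 'X_{1..n.+1}) : 'X_{1..n} := [multinom b (lift i j) | j < n].

Definition chart_pt (y : 'I_n -> K) : 'I_n.+1 -> K :=
  fun k => if unlift i k is Some j then y j else 1.

Lemma dehomogX b : dehomog i 'X_[K, b] = 'X_[chart_mnm b].
Proof.
rewrite /dehomog comp_mpolyX (bigD1_ord i) //= tnth_mktuple unlift_none expr1n mul1r.
rewrite mpolyXE_id; apply: eq_bigr => j _.
by rewrite tnth_mktuple liftK mnmE.
Qed.

Lemma mon_chart_pt y b : mon (chart_pt y) b = mon y (chart_mnm b).
Proof.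
rewrite /mon (bigD1_ord i) //= /chart_pt unlift_none expr1n mul1r.
by apply: eq_bigr => j _; rewrite liftK mnmE.
Qed.

Lemma chart_mnmB b j : chart_mnm (b - U_(lift i j)) = (chart_mnm b - U_(j))%MM.
Proof.
apply/mnmP => k; rewrite mnmE !mnmBE [chart_mnm b k]mnmE !mnm1E.
by rewrite (inj_eq (@lift_inj _ i)).
Qed.

Lemma dehomog_sign_form (e : signs n d) :
  dehomog i (sign_form K e) = \sum_a sgn (e a) 'X_[chart_mnm (expo_mnm a)].
Proof.
rewrite /sign_form /dehomog raddf_sum; apply: eq_bigr => a _ /=.
by rewrite sgn_exp raddf_sgn /= -/(dehomog i _) dehomogX.
Qed.

Lemma dehomog_eval (e : signs n d) y :
  (dehomog i (sign_form K e)).@[y] = form_val e (chart_pt y).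
Proof.
rewrite dehomog_sign_form raddf_sum; apply: eq_bigr => a _ /=.
by rewrite raddf_sgn /= mevalX mon_chart_pt.
Qed.

Lemma dehomog_deriv_eval (e : signs n d) y j :
  ((dehomog i (sign_form K e))^`M(j)).@[y] = part_val e (lift i j) (chart_pt y).
Proof.
rewrite dehomog_sign_form [mderiv j _]raddf_sum raddf_sum; apply: eq_bigr => a _ /=.
rewrite mderiv_sgn mderivX raddf_sgn /= mevalZ mevalX mon_chart_pt chart_mnmB.
by rewrite mnmE.
Qed.

(** A Jacobian row of rank other than 1 is zero, and Euler's formula gives the missing derivative
    along [x i], since that coordinate is 1 on the chart. *)
Lemma singular_chart_degenerate (e : signs n d) : d%:R != 0 :> K ->
  ~ affine_smooth (dehomog i (sign_form K e)) -> degenerate K e.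
Proof.
move=> d0 ns; have [y [y0 ry]] : exists y, (dehomog i (sign_form K e)).@[y] = 0 /\
    \rank (jacobian (dehomog i (sign_form K e)) y) <> 1%N.
  apply: contrapT => H; apply: ns => y y0; apply: contrapT => ry.
  by apply: H; exists y.
have j0 : jacobian (dehomog i (sign_form K e)) y = 0.
  apply/eqP; rewrite -mxrank_eq0; have := rank_leq_row (jacobian (dehomog i (sign_form K e)) y).
  by move: ry; case: (\rank _) => [|[]].
have part0 j : part_val e (lift i j) (chart_pt y) = 0.
  rewrite -dehomog_deriv_eval; have /rowP/(_ j) := j0.
  by rewrite !mxE.
exists (chart_pt y); first by exists i; rewrite /chart_pt unlift_none oner_neq0.
move=> k; case: (unliftP i k) => [j ->|->] //.
have := euler_form e (chart_pt y).
rewrite -dehomog_eval y0 mulr0 (bigD1_ord i) //= big1 ?addr0 => [|j _]; last first.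
  by rewrite part0 mulr0.
by rewrite /chart_pt unlift_none mul1r.
Qed.

End Charts.

(** By contraposition: an integer nonzero in [K] is nonzero in [C], so nondegeneracy passes from [K]
    to [C] by [no_zero_transfer]. *)
Lemma degenerate_specialize (C K : closedFieldType) n d (e : signs n d) :
  (forall c : int, c%:~R = 0 :> C -> c = 0) -> degenerate C e -> degenerate K e.
Proof.
move=> charC [x [i xi] cx]; apply: contrapT => nd.
pose F := [seq mderiv i (int_form e) | i <- enum 'I_n.+1].
have zF (L : closedFieldType) (z : 'I_n.+1 -> L) :
    common_zero (intr : int -> L) F z <-> critical e z.
  split=> [H k|H g /mapP[k _ ->]]; last by rewrite mmap_deriv_form.
  by rewrite -mmap_deriv_form; apply/H/map_f; rewrite mem_enum.
have := @no_zero_transfer int K C intr intr n.+1 d.-1 F _ _ _ x _ i.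
move=> H; case/negP: xi; apply/eqP; apply: H.
- by move=> c; apply: contra_neq => /charC ->.
- by move=> g /mapP[k _ ->]; apply: deriv_form_homog.
- move=> z /zF cz k; apply: contrapT => zk; apply: nd; exists z => //.
  by exists k; apply/eqP.
- exact/zF.
Qed.

(** Two consecutive windows above [N], the rounded-up root of [d], give primes [p1 < p2]. They
    cannot both divide [d], because [p1 * p2 > N ^ 2 >= d]. Each window costs a factor 1024, and the
    rounding a factor 2. *)
Lemma prime_near_sqrt (R : realType) d : (1 < d)%N ->
  exists p, [/\ prime p, odd p, ~~ (p %| d)%N, Num.sqrt d%:R <= p%:R :> R &
    p%:R <= 1024%:R * (1024%:R * 2) * Num.sqrt d%:R :> R].
Proof.
move=> d1; have exN : exists N, (d <= N ^ 2)%N by exists d; rewrite expnS expn1; nia.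
case: (ex_minnP exN) => N dN Nmin.
have N2 : (1 < N)%N by move: dN; case: (N) => [|[|]] //; rewrite ?exp1n ?exp0n //; lia.
have N0 : (0 < N)%N by lia.
have sN : Num.sqrt d%:R <= N%:R :> R.
  rewrite -[N%:R]ger0_norm ?ler0n // -sqrtr_sqr ler_wsqrtr //.
  by rewrite -natrX ler_nat.
have Ns : N%:R <= 2 * Num.sqrt d%:R :> R.
  have pN : (N.-1 ^ 2 < d)%N.
    by rewrite ltnNge; apply/negP => /Nmin; rewrite leqNgt prednK // leqnn.
  have : N.-1%:R <= Num.sqrt d%:R :> R.
    rewrite -[N.-1%:R]ger0_norm ?ler0n // -sqrtr_sqr ler_wsqrtr //.
    by rewrite -natrX ler_nat ltnW.
  have : 1 <= Num.sqrt d%:R :> R by rewrite -[X in X <= _]sqrtr1 ler_wsqrtr // ler1n ltnW.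
  have -> : N%:R = N.-1%:R + 1 :> R by rewrite natr1 prednK.
  by lra.
have [p1 pp1 /andP[lo1 hi1]] := prime_between N0.
have M0 : (0 < 1024 * N)%N by rewrite muln_gt0 N0.
have [p2 pp2 /andP[lo2 hi2]] := prime_between M0.
have near p : (N < p)%N -> (p <= 1024 * (1024 * N))%N -> prime p ->
    [/\ odd p, Num.sqrt d%:R <= p%:R :> R &
     p%:R <= 1024%:R * (1024%:R * 2) * Num.sqrt d%:R :> R].
  move=> Np pN pp; split.
  - by case: (even_prime pp) => [p2E|//]; move: Np; rewrite p2E ltnNge N2.
  - by apply: le_trans sN _; rewrite ler_nat ltnW.
  apply: le_trans (_ : (1024 * (1024 * N))%:R <= _); first by rewrite ler_nat.
  by rewrite !natrM -!mulrA ler_pM2l ?ltr0n // ler_pM2l ?ltr0n.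
have [p1d|p1d] := boolP (p1 %| d)%N; last first.
  have hi1' : (p1 <= 1024 * (1024 * N))%N.
    by apply: leq_trans hi1 _; rewrite leq_pmull.
  by have [o s u] := near p1 lo1 hi1' pp1; exists p1.
have lo2' : (N < p2)%N by apply: leq_trans lo2; rewrite ltnS leq_pmull.
have [o s u] := near p2 lo2' hi2 pp2; exists p2; split=> //.
apply/negP => p2d; have p12 : p1 != p2.
  by apply/eqP => E; move: lo2; rewrite -E ltnNge hi1.
have : (p1 * p2 %| d)%N.
  by rewrite Gauss_dvd ?p1d ?p2d // prime_coprime // dvdn_prime2.
move/dvdn_leq => /(_ (ltnW d1)) /leq_trans /(_ dN).
by rewrite leqNgt expnS expn1 ltn_mul.
Qed.

Lemma closure_of_char p : prime p -> exists K : closedFieldType, p \in [pchar K].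
Proof.
move=> pp; have [K [f _]] := countable_algebraic_closure 'F_p.
exists K; have := pchar_Fp pp; rewrite !inE => /andP[_ /eqP p0].
by rewrite pp -(rmorph_nat f) p0 rmorph0 eqxx.
Qed.

Theorem theorem1p1 (R : realType) (n : nat) (hn : (1 <= n)%N) :
  exists C : R, 0 < C /\
    forall d : nat, (3 <= d)%N ->
      uniform_prob R (fun e : signs n d =>
        ~ smooth_hypersurface (sign_form R[i] e))
      <= C * (Num.sqrt d%:R)^-1.
Proof.
have k1 : 1 <= 1024%:R * (1024%:R * 2) :> R.
  by rewrite -[2]/(2%:R) -!natrM ler1n !muln_gt0.
have [C [C0 CP]] := degenerate_bound n k1.
exists C; split=> // d d3; have d1 : (1 < d)%N by apply: leq_trans d3.
have [p [pp op pd sp ps]] := prime_near_sqrt R d1.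
have [K chp] := closure_of_char pp.
have dK : d%:R != 0 :> K by rewrite -(dvdn_pcharf chp).
apply: le_trans (CP d p K chp op d1 dK sp ps); apply: uniform_prob_le => e ns.
have dC : d%:R != 0 :> R[i] by rewrite pnatr_eq0 -lt0n ltnW.
have [i ni] : exists i, ~ affine_smooth (dehomog i (sign_form R[i] e)).
  by apply/existsNP.
apply: (@degenerate_specialize R[i]); last exact: singular_chart_degenerate ni.
by move=> c /eqP; rewrite intr_eq0 => /eqP.
Qed.
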